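(* Let $\mathfrak{N}$ be a locally compact, compactly generated topological group, let $G\subset\mathfrak{N}$ be a closed subgroup, and let $i_1,i_2\colon H\to G$ be two inclusions of a topological group $H$ onto open subgroups of finite index in $G$, which are conjugated by an automorphism $\phi$ of $\mathfrak{N}$, i.e. $\phi(i_1(h))=i_2(h)$ for all $h\in H$. Let $\Gamma$ be the corresponding $\mathfrak{N}$-BS group, i.e. the topological HNN extension of $G$ with stable letter $t$ and relations $t\,i_1(h)\,t^{-1}=i_2(h)$ for all $h\in H$. If $\mathfrak{N}$ is a-T-menable, then $\Gamma$ is a-T-menable.
   Context: a-T-menability: a locally compact, second countable, compactly generated group $L$ is a-T-menable if and only if there exists a metrically proper affine isometric action of $L$ on some Hilbert space $\mathcal{H}$. Metrically proper means that for every $v\in\mathcal{H}$ and every $r>0$ the set $\{g\in L : \|g\cdot v\|\le r\}$ is relatively compact in $L$. Inclusion: an injective homomorphism that is an isomorphism of topological groups onto its image. $\mathfrak{N}$-BS group: the group $\Gamma$ derived from $(G,H,i_1,i_2)$ by the topological HNN construction; that is, if $G$ is given by the presentation $\langle S\mid R\rangle$, then $\Gamma$ has the presentation $\langle S,t\mid R,\ t\,i_1(h)\,t^{-1}=i_2(h)\ \forall h\in H\rangle$. The group $G$ is regarded as a subgroup of $\Gamma$. The topology on $\Gamma$ is given by the prebasis $\{\gamma U\gamma' : U\text{ open in }G,\ \gamma,\gamma'\in\Gamma\}$; with it $\Gamma$ is a topological group and $G\subset\Gamma$ is an open embedding. *)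

(* Defs.v *)
From HB Require Import structures.
From mathcomp Require Import all_boot all_order all_algebra.
From mathcomp Require Import all_classical all_reals all_analysis.

Set Implicit Arguments.
Unset Strict Implicit.
Unset Printing Implicit Defensive.

Import Order.TTheory GRing.Theory Num.Theory.
Import numFieldNormedType.Exports.

Local Open Scope classical_set_scope.
Local Open Scope quotient_scope.
Local Open Scope group_scope.

(** Topological groups. As for [PreTopologicalNmodule] in the library, the
    "pre" structure only joins the group and the topology; Hausdorffness is
    never required. *)
#[short(type="preTopGroupType")]
HB.structure Definition PreTopGroup := {G of Group G & Topological G}.

HB.mixin Record PreTopGroup_isTopGroup G of PreTopGroup G := {
  mulg_continuous : continuous (fun x : G * G => x.1 * x.2) ;
  invg_continuous : continuous (fun x : G => x^-1) ;
}.

#[short(type="topGroupType")]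
HB.structure Definition TopGroup :=
  {G of PreTopGroup G & PreTopGroup_isTopGroup G}.

Definition is_subgroup (L : groupType) (A : set L) : Prop :=
  [/\ A 1, forall x y, A x -> A y -> A (x * y) & forall x, A x -> A x^-1].

Definition generated_subgroup (L : groupType) (K : set L) : set L :=
  smallest (@is_subgroup L) K.

Definition compactly_generated (L : preTopGroupType) : Prop :=
  exists2 K : set L, compact K & generated_subgroup K = setT.

Definition finite_index (L : groupType) (A : set L) : Prop :=
  finite_set [set [set x * a | a in A] | x in [set: L]].

(** An injective homomorphism that is an isomorphism of topological groups onto
    its image: the last clause says that [f] is open onto its image, for the
    subspace topology. *)
Definition is_inclusion (L M : preTopGroupType) (f : L -> M) : Prop :=
  [/\ {morph f : x y / x * y},
      injective f,
      continuous f &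
      forall U : set L, open U ->
        exists2 V : set M, open V & f @` U = V `&` range f].

Definition is_automorphism (L : preTopGroupType) (phi : L -> L) : Prop :=
  [/\ {morph phi : x y / x * y},
      continuous phi &
      exists psi : L -> L, [/\ cancel phi psi, cancel psi phi & continuous psi]].

(** Real Hilbert spaces: the norm of a complete normed space comes from an inner
    product, i.e. from a symmetric positive definite bilinear form. *)
Record hilbert (R : realType) := Hilbert {
  hilbert_space :> completeNormedModType R ;
  hdot : {dot hilbert_space for (@idfun R)}%R ;
  hdotE : forall v : hilbert_space, hdot v v = (`|v| ^+ 2)%R ;
}.

Section AffineActions.
Context {R : realType} {L : preTopGroupType} {V : hilbert R}.
Implicit Type alpha : L -> V -> V.

Definition is_action alpha : Prop :=
  (forall v, alpha 1 v = v) /\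
  (forall g h v, alpha (g * h) v = alpha g (alpha h v)).

Definition is_affine (f : V -> V) : Prop :=
  exists (l : {linear V -> V}) (b : V), forall v, f v = (l v + b)%R.

Definition is_isometric (f : V -> V) : Prop :=
  forall u v, `|f u - f v|%R = `|u - v|%R.

(** Actions of topological groups are jointly continuous. *)
Definition affine_isometric_action alpha : Prop :=
  [/\ is_action alpha,
      forall g, is_affine (alpha g),
      forall g, is_isometric (alpha g) &
      continuous (fun p : L * V => alpha p.1 p.2)].

(** [precompact A] in the library: the closure of [A] is compact. *)
Definition metrically_proper alpha : Prop :=
  forall (v : V) (r : R), (0 < r)%R ->
    precompact [set g : L | (`|alpha g v| <= r)%R].

End AffineActions.

Definition a_T_menable (R : realType) (L : preTopGroupType) : Prop :=
  exists (V : hilbert R) (alpha : L -> V -> V),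
    affine_isometric_action alpha /\ metrically_proper alpha.

(** The group < S | rel > presented by generators [S] and relations [u = v] for
    [rel u v]. Words are sequences of letters [(s, b)], where [(s, false)] stands
    for the generator [s] and [(s, true)] for its inverse. *)
Section Presentation.
Variables (S : choiceType).

Definition word := seq (S * bool).

Variable rel : word -> word -> Prop.

Definition word_inv (w : word) : word := [seq (x.1, ~~ x.2) | x <- rev w].

Inductive word_cong : word -> word -> Prop :=
| word_cong_refl u : word_cong u u
| word_cong_sym u v : word_cong u v -> word_cong v u
| word_cong_trans u v w : word_cong u v -> word_cong v w -> word_cong u w
| word_cong_cat u u' v v' :
    word_cong u u' -> word_cong v v' -> word_cong (u ++ v) (u' ++ v')
| word_cong_cancel s b : word_cong [:: (s, b); (s, ~~ b)] [::]
| word_cong_rel u v : rel u v -> word_cong u v.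

Definition word_congb (u v : word) : bool := `[< word_cong u v >].

Lemma word_congb_equiv : equiv_class_of word_congb.
Proof.
split=> [u|u v|v u w].
- exact/asboolP/word_cong_refl.
- by apply/asboolP/asboolP; exact: word_cong_sym.
- by move=> /asboolP uv /asboolP vw; apply/asboolP; exact: word_cong_trans uv vw.
Qed.

Canonical word_cong_equiv := EquivRelPack word_congb_equiv.

Definition presented : Type := {eq_quot word_cong_equiv}.
HB.instance Definition _ := Choice.on presented.
HB.instance Definition _ := Quotient.on presented.

Definition presented_class (w : word) : presented := \pi_presented w.

Lemma presented_classP u v :
  reflect (presented_class u = presented_class v) (word_congb u v).
Proof.
rewrite /presented_class; apply: (iffP idP) => [uv|].
  by apply/eqmodP.
by move/eqmodP.
Qed.

Lemma repr_cong u : word_cong (repr (presented_class u)) u.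
Proof. by apply/asboolP/presented_classP; rewrite /presented_class reprK. Qed.

Definition pmul (x y : presented) : presented :=
  presented_class (repr x ++ repr y).
Definition pinv (x : presented) : presented :=
  presented_class (word_inv (repr x)).
Definition pone : presented := presented_class [::].

Lemma word_mulV w : word_cong (w ++ word_inv w) [::].
Proof.
elim: w => [|[s b] w IHw]; first exact: word_cong_refl.
rewrite /word_inv rev_cons map_rcons -cats1 cat_cons catA -cat1s.
apply: word_cong_trans (word_cong_cancel s b).
rewrite -[[:: _; _]]/([:: (s, b)] ++ ([::] ++ [:: (s, ~~ b)])).
apply: word_cong_cat; first exact: word_cong_refl.
by apply: word_cong_cat => //; exact: word_cong_refl.
Qed.

Lemma word_invK w : word_inv (word_inv w) = w.
Proof.
rewrite /word_inv -map_rev revK -map_comp -[RHS]map_id.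
by apply: eq_map => -[s b] /=; rewrite negbK.
Qed.

Lemma word_Vmul w : word_cong (word_inv w ++ w) [::].
Proof. by rewrite -{2}[w]word_invK; exact: word_mulV. Qed.

Lemma pmulE u v :
  pmul (presented_class u) (presented_class v) = presented_class (u ++ v).
Proof.
by apply/presented_classP/asboolP/word_cong_cat; exact: repr_cong.
Qed.

Lemma presented_ind (P : presented -> Prop) :
  (forall w, P (presented_class w)) -> forall x, P x.
Proof. by move=> Pw x; rewrite -[x]reprK; exact: Pw. Qed.

Lemma pmulA : associative pmul.
Proof.
elim/presented_ind=> u; elim/presented_ind=> v; elim/presented_ind=> w.
by rewrite !pmulE catA.
Qed.

Lemma pmul1 : left_id pone pmul.
Proof. by elim/presented_ind=> u; rewrite pmulE. Qed.

Lemma pmulr1 : right_id pone pmul.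
Proof. by elim/presented_ind=> u; rewrite pmulE cats0. Qed.

Lemma pmulVg : left_inverse pone pinv pmul.
Proof.
move=> x; rewrite -{2}[x]reprK -/(presented_class _) pmulE.
exact/presented_classP/asboolP/word_Vmul.
Qed.

Lemma pmulgV : right_inverse pone pinv pmul.
Proof.
move=> x; rewrite -{1}[x]reprK -/(presented_class _) pmulE.
exact/presented_classP/asboolP/word_mulV.
Qed.

HB.instance Definition _ :=
  isGroup.Build presented pmulA pmul1 pmulr1 pmulVg pmulgV.

End Presentation.

(** The topological HNN extension. The presentation of [G] is the tautological
    one: the elements of [G] are the generators and the multiplication table
    gives the relations. The generator [Some g] is the element [g] of [G] and
    [None] is the stable letter. *)
Section HNN.
Variables (H : Type) (G : preTopGroupType) (i1 i2 : H -> G).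

Inductive hnn_rel : word (option G) -> word (option G) -> Prop :=
| hnn_rel_mul g g' :
    hnn_rel [:: (Some g, false); (Some g', false)] [:: (Some (g * g'), false)]
| hnn_rel_conj h :
    hnn_rel [:: (None, false); (Some (i1 h), false); (None, true)]
            [:: (Some (i2 h), false)].

Definition hnn : Type := presented hnn_rel.
HB.instance Definition _ := Group.on hnn.

Definition hnn_base (g : G) : hnn := presented_class hnn_rel [:: (Some g, false)].
Definition hnn_stable : hnn := presented_class hnn_rel [:: (None, false)].

Definition hnn_prebasis : set (set hnn) :=
  [set A | exists (x y : hnn) (U : set G),
     open U /\ A = [set x * hnn_base u * y | u in U]].

HB.instance Definition _ := isSubBaseTopological.Build hnn hnn_prebasis id.

End HNN.

(* Main.v *)
Require Import Defs.
From HB Require Import structures.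
From mathcomp Require Import all_boot all_order all_algebra.
From mathcomp Require Import all_classical all_reals all_analysis.
From mathcomp Require Import zify ring lra.

(** The extension [Gam] acts on two spaces, and neither action is proper, but the
    two together are.

    The first is the Bass-Serre tree. The associated subgroups have finite index
    in [G], so the tree is locally finite, and a bounded tree distance leaves only
    finitely many cosets of [G] ([reach_finite]). The tree distance is the squared
    Hilbert distance between path chains, finitely supported functions on the set
    of edges. Path chains form a cocycle, given by the universal property of the
    extension, and the chain of a shortest path takes the values [1] and [-1] on
    distinct edges ([path_chain_norm]).

    The second is the semidirect product of [N] and the powers of [phi], in which
    [G] is mapped through [j] and the stable letter to [phi]. On each coset
    of [G] the orbit map is a closed embedding.
    A proper kernel on the semidirect product comes from amenability of the
    integers. A proper affine action of [N] with cocycle [b] gives the positive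
    definite Gaussians [exp (- s |b p - b q|^2)], by the Schur product theorem;
    inducing them along a long box of integers gives positive definite kernels
    that are close to [1] on a prescribed bounded set and small off a compact
    subset of [N] times the integers ([box_kernel_lower], [box_kernel_upper]). The
    sum over a suitable sequence of parameters of [1] minus these kernels is
    conditionally negative definite and continuous, and a bound on it confines the
    point of [N] to a compact set ([ambient_kernel_proper]).

    The sum [psi] of the two kernels is an invariant conditionally negative
    definite kernel on [Gam]. By the Gelfand-Naimark-Segal construction there is
    an affine isometric action whose cocycle has squared norm [psi x 1]
    ([gns_affine_isometric_action], [norm_gns0]). Its Hilbert space is the
    reproducing kernel space of a positive definite kernel ([rkhs_hilbert]). A
    sublevel set of [psi] is contained in finitely many translates of compact
    subsets of [G], hence the action is metrically proper. *)

Set Implicit Arguments.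
Unset Strict Implicit.
Unset Printing Implicit Defensive.

Import Order.TTheory GRing.Theory Num.Theory.
Import numFieldNormedType.Exports.

Local Open Scope classical_set_scope.
Local Open Scope ring_scope.

(** * Positive definite and conditionally negative definite kernels *)

Section Kernels.
Context {R : realType}.

(** Formal linear combinations are plain lists, with possible repetitions. *)
Definition ev {X : Type} (f : X -> R) (u : seq (R * X)) : R :=
  \sum_(p <- u) p.1 * f p.2.

Definition form {X : Type} (K : X -> X -> R) (u v : seq (R * X)) : R :=
  ev (fun x => ev (K x) v) u.

Definition scale_comb {X : Type} (a : R) (u : seq (R * X)) : seq (R * X) :=
  [seq (a * p.1, p.2) | p <- u].

Definition psd {X : Type} (K : X -> X -> R) : Prop :=
  (forall x y, K x y = K y x) /\ forall u, 0 <= form K u u.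

Definition cnd {X : Type} (K : X -> X -> R) : Prop :=
  (forall x y, K x y = K y x) /\
  forall u, ev (fun=> 1) u = 0 -> form K u u <= 0.

Section Algebra.
Context {X : Type}.
Implicit Types (f g : X -> R) (K L : X -> X -> R) (u v : seq (R * X)).

Lemma ev_nil f : ev f [::] = 0.
Proof. by rewrite /ev big_nil. Qed.

Lemma ev_cons f p u : ev f (p :: u) = p.1 * f p.2 + ev f u.
Proof. by rewrite /ev big_cons. Qed.

Lemma ev1 f a x : ev f [:: (a, x)] = a * f x.
Proof. by rewrite ev_cons ev_nil addr0. Qed.

Lemma ev_cat f u v : ev f (u ++ v) = ev f u + ev f v.
Proof. by rewrite /ev big_cat. Qed.

Lemma ev_scale f a u : ev f (scale_comb a u) = a * ev f u.
Proof.
by rewrite /ev big_map mulr_sumr; apply: eq_bigr => p _; rewrite mulrA.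
Qed.

Lemma eq_ev f g u : f =1 g -> ev f u = ev g u.
Proof. by move=> fg; apply: eq_bigr => p _; rewrite fg. Qed.

Lemma evD f g u : ev (fun x => f x + g x) u = ev f u + ev g u.
Proof. by rewrite /ev -big_split; apply: eq_bigr => p _ /=; rewrite mulrDr. Qed.

Lemma evZ a f u : ev (fun x => a * f x) u = a * ev f u.
Proof. by rewrite /ev mulr_sumr; apply: eq_bigr => p _; rewrite mulrCA. Qed.

Lemma evZr a f u : ev (fun x => f x * a) u = ev f u * a.
Proof. by rewrite mulrC -evZ; apply: eq_ev => x; rewrite mulrC. Qed.

Lemma evN f u : ev (fun x => - f x) u = - ev f u.
Proof.
by rewrite -mulN1r -evZ; apply: eq_ev => x; rewrite mulN1r.
Qed.

Lemma ev0 u : ev (fun=> 0) u = 0.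
Proof. by rewrite /ev big1// => p _; rewrite mulr0. Qed.

Lemma ev_mul f g u : ev (fun x => f x * g x) u = ev g [seq (p.1 * f p.2, p.2) | p <- u].
Proof. by rewrite /ev big_map; apply: eq_bigr => p _; rewrite mulrA. Qed.

Lemma exchange_ev {Y : Type} (F : X -> Y -> R) u (v : seq (R * Y)) :
  ev (fun x => ev (F x) v) u = ev (fun y => ev (F^~ y) u) v.
Proof.
rewrite /ev.
under eq_bigr do rewrite mulr_sumr.
rewrite exchange_big; apply: eq_bigr => q _; rewrite mulr_sumr.
by apply: eq_bigr => p _; rewrite mulrCA.
Qed.

Lemma formC K u v : (forall x y, K x y = K y x) -> form K u v = form K v u.
Proof.
move=> Ks; rewrite /form exchange_ev; apply: eq_ev => x.
by apply: eq_ev => y; exact: Ks.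
Qed.

Lemma eq_form K L u v : K =2 L -> form K u v = form L u v.
Proof. by move=> KL; apply: eq_ev => x; apply: eq_ev => y; exact: KL. Qed.

Lemma formD K L u v :
  form (fun x y => K x y + L x y) u v = form K u v + form L u v.
Proof. by rewrite /form -evD; apply: eq_ev => x; rewrite evD. Qed.

Lemma formZ a K u v : form (fun x y => a * K x y) u v = a * form K u v.
Proof. by rewrite /form -evZ; apply: eq_ev => x; rewrite evZ. Qed.

Lemma form_rank1 f g u v : form (fun x y => f x * g y) u v = ev f u * ev g v.
Proof. by rewrite /form -evZr; apply: eq_ev => x; rewrite evZ. Qed.

Lemma form_left f u v : form (fun x _ => f x) u v = ev f u * ev (fun=> 1) v.
Proof. by rewrite -form_rank1; apply: eq_form => x y; rewrite mulr1. Qed.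

Lemma form_right f u v : form (fun _ y => f y) u v = ev (fun=> 1) u * ev f v.
Proof. by rewrite -form_rank1; apply: eq_form => x y; rewrite mul1r. Qed.

Lemma form_catl K u v w : form K (u ++ v) w = form K u w + form K v w.
Proof. exact: ev_cat. Qed.

Lemma form_catr K u v w : form K u (v ++ w) = form K u v + form K u w.
Proof. by rewrite /form -evD; apply: eq_ev => x; rewrite ev_cat. Qed.

Lemma form_scalel K a u w : form K (scale_comb a u) w = a * form K u w.
Proof. exact: ev_scale. Qed.

Lemma form_scaler K a u w : form K u (scale_comb a w) = a * form K u w.
Proof. by rewrite /form -evZ; apply: eq_ev => x; rewrite ev_scale. Qed.

End Algebra.

Lemma ev_map {X Y : Type} (h : X -> Y) (f : Y -> R) u :
  ev f [seq (p.1, h p.2) | p <- u] = ev (f \o h) u.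
Proof. by rewrite /ev big_map. Qed.

Lemma form_map {X Y : Type} (h : X -> Y) (K : Y -> Y -> R) u v :
  form K [seq (p.1, h p.2) | p <- u] [seq (p.1, h p.2) | p <- v] =
  form (fun x y => K (h x) (h y)) u v.
Proof. by rewrite /form ev_map; apply: eq_ev => x /=; rewrite ev_map. Qed.

Section PositiveKernels.
Context {X : Type}.
Implicit Types (f : X -> R) (K L : X -> X -> R).

Lemma psd_comp {Y : Type} (h : Y -> X) K :
  psd K -> psd (fun x y => K (h x) (h y)).
Proof.
by move=> [Ks K0]; split=> [x y|u]; [exact: Ks|rewrite -form_map; exact: K0].
Qed.

Lemma eq_psd K L : K =2 L -> psd K -> psd L.
Proof.
move=> KL [Ks K0]; split=> [x y|u]; first by rewrite -!KL.
by rewrite -(eq_form _ _ KL).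
Qed.

Lemma psdZ a K : 0 <= a -> psd K -> psd (fun x y => a * K x y).
Proof.
move=> a0 [Ks K0]; split=> [x y|u]; first by rewrite Ks.
by rewrite formZ mulr_ge0.
Qed.

Lemma psdD K L : psd K -> psd L -> psd (fun x y => K x y + L x y).
Proof.
move=> [Ks K0] [Ls L0]; split=> [x y|u]; first by rewrite Ks Ls.
by rewrite formD addr_ge0.
Qed.

Lemma psd_rank1 f : psd (fun x y => f x * f y).
Proof.
by split=> [x y|u]; [exact: mulrC|rewrite form_rank1 -expr2 sqr_ge0].
Qed.

Lemma psd_diag_ge0 K x : psd K -> 0 <= K x x.
Proof.
by move=> [_ /(_ [:: (1, x)])]; rewrite /form !ev1 !mul1r.
Qed.

Lemma form_cons0 K c x u : (forall y, K x y = 0) -> (forall y, K y x = 0) ->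
  form K ((c, x) :: u) ((c, x) :: u) = form K u u.
Proof.
move=> Kx Kx'; rewrite /form ev_cons /= ev_cons /= Kx.
rewrite (eq_ev _ Kx) ev0 !(mulr0, addr0, add0r).
by apply: eq_ev => y; rewrite ev_cons Kx' mulr0 add0r.
Qed.

(** A null vector of a positive form is orthogonal to everything. *)
Lemma psd_vanish K x y : psd K -> K x x = 0 -> K x y = 0.
Proof.
move=> [Ks K0] Kx0; apply/eqP/negPn/negP => Kxy.
(* The coefficient of [x] is chosen to give the form the value [-1]. *)
have := K0 [:: (- (K y y + 1) / (2 * K x y), x); (1, y)].
rewrite /form !ev_cons !ev_nil /= Kx0 (Ks y x).
set a := _ / _ => H.
have Ea : 2 * (a * K x y) = - (K y y + 1) by rewrite /a; field.
by lra.
Qed.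

(** One step of Cholesky elimination: the form of the deflated kernel at [u] is
    that of [K] at the projection of [u] orthogonal to [x]. *)
Lemma psd_deflate K x : psd K -> K x x != 0 ->
  psd (fun y z => K y z - K x y * K x z / K x x).
Proof.
move=> [Ks K0] Kx; split=> [y z|u]; first by rewrite (Ks y) (mulrC (K x y)).
set e := ev (K x) u.
have := K0 (u ++ [:: (- (e / K x x), x)]).
rewrite form_catl !form_catr (formC [:: _] u)// /form.
rewrite !ev1 -/(form K u u) -/e.
have -> : ev (fun y => ev (K y) [:: (- (e / K x x), x)]) u = - (e / K x x) * e.
  by rewrite /e -evZ; apply: eq_ev => y; rewrite ev1 Ks.
rewrite (_ : ev _ u = form K u u - e * e / K x x).
  move=> H; apply: le_trans H _; rewrite le_eqVlt; apply/orP; left; apply/eqP.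
  by field.
rewrite -/(form _ u u) formD; congr (_ + _).
rewrite -[e * e]form_rank1 mulrC -mulNr -formZ.
by apply: eq_form => y z; rewrite mulNr [in RHS]mulrC.
Qed.

(** Schur product theorem. Removing from the first kernel its rank-one part at
    a point [x] leaves a positive definite kernel that vanishes at [x], so the
    points of the list can be eliminated one by one. *)
Lemma psdM K L : psd K -> psd L -> psd (fun x y => K x y * L x y).
Proof.
move=> Kp [Ls L0]; split=> [x y|u]; first by rewrite Ls Kp.1.
elim: u => [|[c x] u IHu] in K Kp *; first by rewrite /form ev_nil.
have [Kx|Kx] := eqVneq (K x x) 0.
  have K1 y : K x y = 0 by exact: psd_vanish.
  rewrite form_cons0 => [|y|y]; first exact: IHu.
    by rewrite K1 mul0r.
  by rewrite Kp.1 K1 mul0r.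
pose K' y z := K y z - K x y * K x z / K x x.
have K'p : psd K' by exact: psd_deflate.
have -> : form (fun y z => K y z * L y z) ((c, x) :: u) ((c, x) :: u) =
  form (fun y z => K' y z * L y z) u u +
  (K x x)^-1 * form (fun y z => (K x y * K x z) * L y z)
     ((c, x) :: u) ((c, x) :: u).
  rewrite -(@form_cons0 (fun y z => K' y z * L y z) c x u) => [|y|y].
  - by rewrite -formZ -formD; apply: eq_form => y z; rewrite /K'; field.
  - by rewrite /K' mulrAC divff// mul1r subrr mul0r.
  - by rewrite /K' -mulrA divff// mulr1 Kp.1 subrr mul0r.
rewrite addr_ge0 ?IHu// mulr_ge0 ?invr_ge0 ?psd_diag_ge0//.
move: (_ :: u) => v.
rewrite (_ : form _ v v =
  form L [seq (p.1 * K x p.2, p.2) | p <- v] [seq (p.1 * K x p.2, p.2) | p <- v]).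
  exact: L0.
rewrite /form -[RHS]ev_mul; apply: eq_ev => y.
by rewrite -ev_mul -evZ; apply: eq_ev => z; rewrite mulrA.
Qed.

Lemma psdX K n : psd K -> psd (fun x y => K x y ^+ n).
Proof.
move=> Kp; elim: n => [|n IHn].
  by apply: eq_psd (psd_rank1 (fun=> 1)) => x y; rewrite mulr1 expr0.
by apply: eq_psd (psdM Kp IHn) => x y; rewrite exprS.
Qed.

Lemma cvg_ev (f_ : nat -> X -> R) f u :
  (forall x, f_ n x @[n --> \oo] --> f x) -> ev (f_ n) u @[n --> \oo] --> ev f u.
Proof.
move=> ff; rewrite /ev; apply: cvg_big => [|p _]; first exact: add_continuous.
by apply: cvgMl_tmp; exact: ff.
Qed.

Lemma cvg_form (K_ : nat -> X -> X -> R) K u v :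
  (forall x y, K_ n x y @[n --> \oo] --> K x y) ->
  form (K_ n) u v @[n --> \oo] --> form K u v.
Proof.
by move=> KK; apply: cvg_ev => x; apply: cvg_ev => y; exact: KK.
Qed.

Lemma psd_lim (K_ : nat -> X -> X -> R) K : (forall n, psd (K_ n)) ->
  (forall x y, K_ n x y @[n --> \oo] --> K x y) -> psd K.
Proof.
move=> Kp KK; split=> [x y|u].
  rewrite -(cvg_lim _ (KK x y))// -(cvg_lim _ (KK y x))//.
  by under eq_fun do rewrite (Kp _).1.
have C := cvg_form (u := u) (v := u) KK.
rewrite -(cvg_lim _ C)//; apply: limr_ge; first by apply: cvgP C.
by apply: nearW => n; exact: (Kp n).2.
Qed.

Lemma psd_sum (I : Type) (r : seq I) (F : I -> X -> X -> R) :
  (forall i, psd (F i)) -> psd (fun x y => \sum_(i <- r) F i x y).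
Proof.
move=> Fp; elim: r => [|i r IHr].
  by apply: eq_psd (psd_rank1 (fun=> 0)) => x y; rewrite mulr0 big_nil.
by apply: eq_psd (psdD (Fp i) IHr) => x y; rewrite big_cons.
Qed.

(** The exponential series has nonnegative coefficients, and powers are positive
    definite by the Schur product theorem. *)
Lemma psd_exp K : psd K -> psd (fun x y => expR (K x y)).
Proof.
move=> Kp.
apply: (psd_lim (K_ := fun n x y => series (exp_coeff (K x y)) n)) => [n|x y].
  rewrite /series /=.
  apply: psd_sum => i; rewrite /exp_coeff /=.
  under eq_fun do under eq_fun do rewrite mulrC.
  by apply: psdZ; [rewrite invr_ge0|exact: psdX].
exact: is_cvg_series_exp_coeff.
Qed.

End PositiveKernels.
End Kernels.

(** * The Hilbert space of a positive definite kernel *)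

Section ReproducingKernel.
Context {R : realType} {X : Type}.
Variable K : X -> X -> R.
Hypothesis Kp : psd K.
Implicit Types (f g : X -> R) (u v : seq (R * X)).

Local Notation Q u := (form K u u).

(** In the Hilbert space generated by [K] the inner product of a vector [f] with
    the combination [u] is [ev f u], and [gain f u] is [|f|^2 - |f - u|^2]. As
    the combinations are dense, its supremum over [u] is [|f|^2]. Taking this
    supremum as the definition of the norm describes the completed space
    directly, as a set of functions, without Cauchy sequences or quotients. *)
Definition gain f u : R := 2 * ev f u - Q u.

Definition in_rkhs f : Prop := exists c, forall u, gain f u <= c.

Definition sqn f : R := sup [set gain f u | u in setT].

Definition feature u : X -> R := fun x => ev (K x) u.

Lemma gain_le_sqn f u : in_rkhs f -> gain f u <= sqn f.
Proof.
move=> [c fc]; apply: ub_le_sup; last by exists u.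
by exists c => _ [v _ <-].
Qed.

Lemma sqn_le f c : (forall u, gain f u <= c) -> sqn f <= c.
Proof.
move=> fc; apply: ge_sup; first by exists (gain f [::]); exists [::].
by move=> _ [v _ <-].
Qed.

Lemma sqn_ge0 f : in_rkhs f -> 0 <= sqn f.
Proof.
move=> fH; apply: le_trans (gain_le_sqn [::] fH).
by rewrite /gain /form !ev_nil mulr0 subrr.
Qed.

Lemma sqn_approx f e : 0 < e -> in_rkhs f -> exists u, sqn f - e < gain f u.
Proof.
move=> e0 [c fc].
have hs : has_sup [set gain f u | u in setT].
  split; first by exists (gain f [::]); exists [::].
  by exists c => _ [v _ <-].
by have [_ [u _ <-] ?] := sup_adherent e0 hs; exists u.
Qed.

Lemma form_ge0 u : 0 <= Q u. Proof. exact: Kp.2. Qed.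

Lemma form_addC u v : form K (u ++ v) (u ++ v) = Q u + 2 * form K u v + Q v.
Proof.
rewrite form_catl !form_catr (formC v u Kp.1); ring.
Qed.

Lemma gain_scale f a u : gain f (scale_comb a u) = 2 * a * ev f u - a ^+ 2 * Q u.
Proof. by rewrite /gain ev_scale form_scalel form_scaler; ring. Qed.

(** Cauchy-Schwarz, by optimizing the scale of [u] in [gain_le_sqn]. *)
Lemma sqr_ev_le f u : in_rkhs f -> ev f u ^+ 2 <= sqn f * Q u.
Proof.
move=> fH.
have G a : 2 * a * ev f u - a ^+ 2 * Q u <= sqn f.
  by rewrite -gain_scale; exact: gain_le_sqn.
have [Q0|Qn0] := eqVneq (Q u) 0.
  have [->|e0] := eqVneq (ev f u) 0; first by rewrite expr0n Q0 mulr0.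
  (* On a null vector the gain is linear in the scale; this one exceeds [sqn f]. *)
  have := G ((sqn f + 1) / (2 * ev f u)); rewrite Q0 mulr0 subr0.
  have -> : 2 * ((sqn f + 1) / (2 * ev f u)) * ev f u = sqn f + 1 by field.
  by rewrite gerDl ler10.
have Qp : 0 < Q u by rewrite lt_def Qn0 form_ge0.
have := G (ev f u / Q u).
have -> : 2 * (ev f u / Q u) * ev f u - (ev f u / Q u) ^+ 2 * Q u =
          ev f u ^+ 2 / Q u by field.
by rewrite ler_pdivrMr.
Qed.

Definition nrm f : R := Num.sqrt (sqn f).

Lemma nrm_ge0 f : 0 <= nrm f. Proof. exact: sqrtr_ge0. Qed.

Lemma sqr_nrm f : in_rkhs f -> nrm f ^+ 2 = sqn f.
Proof. by move=> fH; rewrite sqr_sqrtr// sqn_ge0. Qed.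

Lemma ev_le_nrm f u : in_rkhs f -> `|ev f u| <= nrm f * Num.sqrt (Q u).
Proof.
move=> fH; rewrite -sqrtr_sqr -sqrtrM ?sqn_ge0// ler_sqrt; last first.
  by rewrite mulr_ge0 ?sqn_ge0 ?form_ge0.
exact: sqr_ev_le.
Qed.

Lemma gain_le_sqr f c u : 0 <= c -> `|ev f u| <= c * Num.sqrt (Q u) ->
  gain f u <= c ^+ 2.
Proof.
move=> c0 fc; rewrite /gain -{1}[Q u]sqr_sqrtr ?form_ge0//.
move: (Num.sqrt _) fc => s fc.
have := sqr_ge0 (c - s); have := le_trans (ler_norm _) fc.
by rewrite sqrrB; lra.
Qed.

Lemma in_rkhs_bound f c : 0 <= c ->
  (forall u, `|ev f u| <= c * Num.sqrt (Q u)) -> in_rkhs f.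
Proof. by move=> c0 fc; exists (c ^+ 2) => u; exact: gain_le_sqr. Qed.

Lemma nrm_le f c : 0 <= c ->
  (forall u, `|ev f u| <= c * Num.sqrt (Q u)) -> nrm f <= c.
Proof.
move=> c0 fc; rewrite -[leRHS]ger0_norm// -sqrtr_sqr ler_sqrt ?sqr_ge0//.
by apply: sqn_le => u; exact: gain_le_sqr.
Qed.

Lemma ev_lin a f g u : ev (a *: f + g) u = a * ev f u + ev g u.
Proof. by rewrite -evZ -evD; exact: eq_ev. Qed.

Lemma rkhs_lin_bound a f g u : in_rkhs f -> in_rkhs g ->
  `|ev (a *: f + g) u| <= (`|a| * nrm f + nrm g) * Num.sqrt (Q u).
Proof.
move=> fH gH; rewrite ev_lin mulrDl -mulrA.
apply: (le_trans (ler_normD _ _)); rewrite normrM lerD ?ev_le_nrm//.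
by rewrite ler_wpM2l// ev_le_nrm.
Qed.

Lemma rkhs_lin a f g : in_rkhs f -> in_rkhs g -> in_rkhs (a *: f + g).
Proof.
move=> fH gH; apply: (@in_rkhs_bound _ (`|a| * nrm f + nrm g)) => [|u].
  by rewrite addr_ge0 ?mulr_ge0 ?nrm_ge0.
exact: rkhs_lin_bound.
Qed.

Lemma rkhs0 : in_rkhs 0.
Proof.
exists 0 => u; rewrite /gain (_ : ev 0 u = 0); last exact: (ev0 u).
by rewrite mulr0 sub0r oppr_le0 form_ge0.
Qed.

Lemma nrm_lin a f g : in_rkhs f -> in_rkhs g ->
  nrm (a *: f + g) <= `|a| * nrm f + nrm g.
Proof.
move=> fH gH; apply: nrm_le => [|u]; last exact: rkhs_lin_bound.
by rewrite addr_ge0 ?mulr_ge0 ?nrm_ge0.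
Qed.

Lemma rkhsZ a f : in_rkhs f -> in_rkhs (a *: f).
Proof. by move=> fH; rewrite -[a *: f]addr0; apply: rkhs_lin => //; exact: rkhs0. Qed.

Lemma rkhsD f g : in_rkhs f -> in_rkhs g -> in_rkhs (f + g).
Proof. by move=> fH gH; rewrite -[f]scale1r; exact: rkhs_lin. Qed.

Lemma nrm0 : nrm 0 = 0.
Proof.
apply/eqP; rewrite eq_le nrm_ge0 andbT; apply: nrm_le => // u.
by rewrite (_ : ev 0 u = 0) ?normr0 ?mul0r//; exact: (ev0 u).
Qed.

Lemma nrmZ a f : in_rkhs f -> nrm (a *: f) = `|a| * nrm f.
Proof.
move=> fH; apply/eqP; rewrite eq_le; apply/andP; split.
  by rewrite -[a *: f]addr0 (le_trans (nrm_lin _ _ rkhs0))// nrm0 addr0.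
have [->|a0] := eqVneq a 0; first by rewrite normr0 mul0r nrm_ge0.
rewrite -ler_pdivlMl ?normr_gt0// -normfV.
rewrite -{1}[f]scale1r -(mulVf a0) -scalerA -[_ *: (a *: f)]addr0.
apply: (le_trans (nrm_lin _ (rkhsZ _ fH) rkhs0)).
by rewrite nrm0 addr0.
Qed.

Lemma nrmD f g : in_rkhs f -> in_rkhs g -> nrm (f + g) <= nrm f + nrm g.
Proof.
move=> fH gH; rewrite -{1}[f]scale1r; apply: (le_trans (nrm_lin _ fH gH)).
by rewrite normr1 mul1r.
Qed.

Lemma nrm_eq0 f : in_rkhs f -> nrm f = 0 -> f = 0.
Proof.
move=> fH f0; apply/funext => x; have := ev_le_nrm [:: (1, x)] fH.
by rewrite f0 mul0r ev1 mul1r normr_le0 => /eqP.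
Qed.

Lemma ev_feature u v : ev (feature u) v = form K v u.
Proof. by []. Qed.

(** Translating [f] by a feature completes a square in the gain. *)
Lemma gain_feature f u v :
  gain (f + feature u) (v ++ u) = gain f v + 2 * ev f u + Q u.
Proof.
rewrite /gain (evD f (feature u)) !ev_cat !ev_feature form_addC; ring.
Qed.

Lemma gain_cancel f u v : gain f ((v ++ scale_comb (-1) u) ++ u) = gain f v.
Proof.
rewrite /gain !form_addC !ev_cat ev_scale.
rewrite !(form_catl, form_scalel, form_scaler); ring.
Qed.

Lemma sqn_feature f u : in_rkhs f ->
  sqn (f + feature u) = sqn f + 2 * ev f u + Q u.
Proof.
move=> fH.
have le v : gain (f + feature u) v <= sqn f + 2 * ev f u + Q u.
  rewrite -(gain_cancel _ u v) gain_feature !lerD2r.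
  exact: gain_le_sqn.
apply/eqP; rewrite eq_le sqn_le//=.
rewrite -addrA -lerBrDr; apply: sqn_le => v; rewrite lerBrDr addrA.
rewrite -gain_feature; apply: gain_le_sqn.
by exists (sqn f + 2 * ev f u + Q u).
Qed.

Lemma sqn0 : sqn 0 = 0.
Proof. by rewrite -(sqr_nrm rkhs0) nrm0 expr0n. Qed.

Lemma rkhs_feature u : in_rkhs (feature u).
Proof.
exists (Q u) => v.
rewrite /gain ev_feature lerBlDr.
have := form_ge0 (u ++ scale_comb (-1) v).
rewrite form_addC form_scalel !form_scaler (formC v u Kp.1).
lra.
Qed.

Lemma sqn_feature1 u : sqn (feature u) = Q u.
Proof.
rewrite -[feature u]add0r sqn_feature ?sqn0 ?(ev0 u : ev 0 u = 0); last exact: rkhs0.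
by rewrite mulr0 !add0r.
Qed.

Lemma featureN u : - feature u = feature (scale_comb (-1) u).
Proof. by apply/funext => x; rewrite /feature ev_scale mulN1r. Qed.

(** The features span a dense subspace: [u] almost realizes the supremum
    defining [|f|^2] exactly when it is close to [f]. *)
Lemma feature_dense f e : 0 < e -> in_rkhs f ->
  exists u, nrm (f - feature u) <= e.
Proof.
move=> e0 fH; have [u fu] := sqn_approx (exprn_gt0 2 e0) fH.
exists u; rewrite /nrm -[leRHS]ger0_norm ?(ltW e0)// -sqrtr_sqr.
rewrite ler_sqrt ?sqr_ge0// featureN sqn_feature//.
rewrite ev_scale form_scalel form_scaler.
by move: fu; rewrite /gain; lra.
Qed.

(** Polarization. *)
Definition dotk f g : R := (sqn (f + g) - sqn f - sqn g) / 2.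

Lemma dotkC f g : dotk f g = dotk g f.
Proof. by rewrite /dotk (addrC f g); ring. Qed.

Lemma dotk_feature f u : in_rkhs f -> dotk (feature u) f = ev f u.
Proof.
by move=> fH; rewrite /dotk (addrC _ f) sqn_feature// sqn_feature1; field.
Qed.

Lemma dotkk f : in_rkhs f -> dotk f f = sqn f.
Proof.
move=> fH; rewrite /dotk.
have -> : f + f = 2 *: f by rewrite scaler_nat.
rewrite -(sqr_nrm (rkhsZ 2 fH)) nrmZ// exprMn sqr_nrm//.
by rewrite ger0_norm//; field.
Qed.

Lemma sqn_near f g : in_rkhs f -> in_rkhs g ->
  `|sqn f - sqn g| <= nrm (f - g) * (2 * nrm f + nrm (f - g)).
Proof.
move=> fH gH.
have gH' : in_rkhs (- g) by rewrite -scaleN1r; exact: rkhsZ.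
have hH : in_rkhs (f - g) by exact: rkhsD.
have hH' : in_rkhs (g - f).
  by rewrite -opprB -scaleN1r; exact: rkhsZ.
have E : nrm (g - f) = nrm (f - g).
  by rewrite -(opprB f g) -scaleN1r nrmZ// normrN1 mul1r.
have := nrmD hH gH; rewrite subrK.
have := nrmD hH' fH; rewrite subrK E -!sqr_nrm//.
have := nrm_ge0 f; have := nrm_ge0 g; have := nrm_ge0 (f - g).
move: (nrm _) (nrm _) (nrm _) => d a b d0 a0 b0 ab ba.
rewrite ler_norml; apply/andP; split; nra.
Qed.

Lemma dotk_near f g u : in_rkhs f -> in_rkhs g ->
  `|dotk f g - ev g u| <=
  nrm (f - feature u) * (nrm (f + g) + nrm f + nrm (f - feature u)).
Proof.
move=> fH gH; have uH := rkhs_feature u.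
rewrite -dotk_feature// /dotk.
have := sqn_near fH uH.
have := sqn_near (rkhsD fH gH) (rkhsD uH gH).
rewrite (_ : f + g - (feature u + g) = f - feature u); last first.
  by rewrite opprD addrACA subrr addr0.
move: (nrm _) (nrm _) (nrm _) (sqn _) (sqn _) (sqn _) (sqn _) (sqn _).
move=> d a b x y z t s; rewrite !ler_norml => /andP[? ?] /andP[? ?].
apply/andP; split; nra.
Qed.

(** Against a feature the inner product is an evaluation, which is linear; a
    general [f] is a limit of features. *)
Lemma dotk_linear f a g h : in_rkhs f -> in_rkhs g -> in_rkhs h ->
  dotk f (a *: g + h) = a * dotk f g + dotk f h.
Proof.
move=> fH gH hH.
have /choice[u fu] : forall n, exists u, nrm (f - feature u) <= n.+1%:R^-1.
  by move=> n; apply: feature_dense => //; rewrite invr_gt0.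
have cv k : in_rkhs k -> ev k (u n) @[n --> \oo] --> dotk f k.
  move=> kH; apply/cvgrPdist_le => e e0.
  pose M := nrm (f + k) + nrm f + 1.
  have M0 : 0 < M by rewrite ltr_wpDl// addr_ge0 ?nrm_ge0.
  have := near_infty_natSinv_lt (PosNum (divr_gt0 e0 M0)).
  apply: filterS => n /= ne.
  apply: (le_trans (dotk_near _ fH kH)).
  have n1 : nrm (f - feature (u n)) <= 1.
    by rewrite (le_trans (fu n))// invf_le1// ler1n.
  apply: (@le_trans _ _ (n.+1%:R^-1 * M)).
    by apply: ler_pM => //; rewrite ?addr_ge0 ?nrm_ge0 // /M !lerD2l.
  by rewrite -ler_pdivlMr// ltW.
have ghH := rkhs_lin a gH hH.
have lim : ev (a *: g + h) (u n) @[n --> \oo] --> a * dotk f g + dotk f h.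
  rewrite (_ : (fun n => _) = fun n => a * ev g (u n) + ev h (u n)).
    by apply: cvgD; [apply: cvgMl_tmp|]; exact: cv.
  by apply/funext => n; exact: ev_lin.
exact: cvg_unique (cv _ ghH) lim.
Qed.

End ReproducingKernel.

Section RKHS.
Context {R : realType} {X : Type} {K : X -> X -> R}.

Definition rkhs_pred : {pred X -> R} := mem [set f | in_rkhs K f].

(** The proof that [K] is positive definite is a parameter of the type because
    the vector space structure depends on it. *)
Record rkhs (Kp : psd K) := Rkhs {
  rkhs_fun :> X -> R;
  rkhs_funP : rkhs_fun \in rkhs_pred }.

Variable Kp : psd K.

HB.instance Definition _ := [isSub for @rkhs_fun Kp].
HB.instance Definition _ := [Choice of rkhs Kp by <:].

Lemma rkhs_submod_closed : submod_closed rkhs_pred.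
Proof.
split; first by rewrite inE; exact: rkhs0.
by move=> a f g; rewrite !inE; exact: rkhs_lin.
Qed.

End RKHS.

Section RKHSModule.
Context {R : realType} {X : Type} {K : X -> X -> R}.
Variable Kp : psd K.

(* The instance is local because it depends on [Kp], which [rkhs_pred] does not
   mention. *)
#[local] HB.instance Definition _ := GRing.isSubmodClosed.Build _ _ (@rkhs_pred R X K)
  (rkhs_submod_closed Kp).
HB.instance Definition _ := [SubChoice_isSubLmodule of rkhs Kp by <:].

Lemma rkhsP (f : rkhs Kp) : in_rkhs K f.
Proof. by have := rkhs_funP f; rewrite inE. Qed.

Definition rkhs_norm (f : rkhs Kp) : R := nrm K f.

Lemma rkhs_normD f g : rkhs_norm (f + g) <= rkhs_norm f + rkhs_norm g.
Proof. exact: (nrmD Kp (rkhsP f) (rkhsP g)). Qed.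

Lemma rkhs_normZ a f : rkhs_norm (a *: f) = `|a| * rkhs_norm f.
Proof. exact: (nrmZ Kp a (rkhsP f)). Qed.

Lemma rkhs_norm_eq0 f : rkhs_norm f = 0 -> f = 0.
Proof. by move=> /(nrm_eq0 Kp (rkhsP f)) f0; exact: val_inj. Qed.

HB.instance Definition _ := Lmodule_isNormed.Build R (rkhs Kp)
  rkhs_normD rkhs_normZ rkhs_norm_eq0.

Lemma rkhs_normE (f : rkhs Kp) : `|f| = nrm K f.
Proof. by []. Qed.

Definition rkhs_dot (f g : rkhs Kp) : R := dotk K f g.

Lemma rkhs_dot_bilinear : bilinear_for *%R *%R rkhs_dot.
Proof.
split=> f a g h; rewrite /rkhs_dot /=; last first.
  by rewrite (dotk_linear Kp); try exact: rkhsP.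
by rewrite !(dotkC K _ f) (dotk_linear Kp)//; exact: rkhsP.
Qed.

End RKHSModule.

Section RKHSHilbert.
Context {R : realType} {X : Type} {K : X -> X -> R}.
Variable Kp : psd K.

#[local] HB.instance Definition _ := bilinear_isBilinear.Build R _ _ _ _ _
  (@rkhs_dot R X K Kp) (rkhs_dot_bilinear Kp).

Lemma rkhs_dotC (f g : rkhs Kp) :
  rkhs_dot f g = (-1) ^+ false * idfun (rkhs_dot g f).
Proof. by rewrite mul1r /rkhs_dot dotkC. Qed.

Lemma rkhs_dotE (f : rkhs Kp) : rkhs_dot f f = `|f| ^+ 2.
Proof.
by rewrite /rkhs_dot (dotkk Kp (rkhsP f)) rkhs_normE (sqr_nrm (rkhsP f)).
Qed.

Lemma rkhs_dot_gt0 (f : rkhs Kp) : f != 0 -> 0 < rkhs_dot f f.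
Proof. by move=> f0; rewrite rkhs_dotE exprn_gt0// normr_gt0. Qed.

#[local] HB.instance Definition _ :=
  @isHermitianSesquilinear.Build R (rkhs Kp) false idfun (@rkhs_dot R X K Kp) rkhs_dotC.
#[local] HB.instance Definition _ :=
  @isDotProduct.Build R (rkhs Kp) (@rkhs_dot R X K Kp) rkhs_dot_gt0.

Lemma ev_le_norm (f : rkhs Kp) u : `|ev f u| <= `|f| * Num.sqrt (form K u u).
Proof. by apply: (ev_le_nrm Kp); exact: rkhsP. Qed.

Lemma ev_rkhsB (f g : rkhs Kp) u : ev (f - g) u = ev f u - ev g u.
Proof. by rewrite (evD f (fun x => - g x)) evN. Qed.

(** A Cauchy filter converges pointwise, and the bounds [|ev (f - g) u| <= e |u|],
    which define the norm, pass to pointwise limits. *)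
Lemma rkhs_complete (F : set_system (rkhs Kp)) :
  ProperFilter F -> cauchy F -> cvg F.
Proof.
move=> FF /cauchyP Fc.
have near_e (e : R) : 0 < e -> exists g : rkhs Kp,
    F [set f : rkhs Kp | forall u, `|ev g u - ev f u| <= e * Num.sqrt (form K u u)].
  move=> e0; have [g Fg] := Fc _ e0; exists g; apply: filterS Fg => f.
  rewrite -ball_normE /= => fg u; rewrite -ev_rkhsB.
  by apply: le_trans (ev_le_norm _ _) _; rewrite ler_wpM2r ?sqrtr_ge0// ltW.
have point x : exists l : R, (fun f : rkhs Kp => f x) @ F --> l.
  suff /cauchy_cvg : cauchy ((fun f : rkhs Kp => f x) @ F) by move/cvg_ex.
  apply: cauchy_exP => e e0.
  pose s := Num.sqrt (form K [:: (1, x)] [:: (1, x)]) + 1.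
  have s0 : 0 < s by rewrite ltr_wpDl// sqrtr_ge0.
  have [g Fg] := near_e _ (divr_gt0 e0 s0).
  exists (g x); rewrite /nbhs /=; apply: filterS Fg => f /= /(_ [:: (1, x)]).
  rewrite !ev1 !mul1r -ball_normE /= => /le_lt_trans; apply.
  by rewrite mulrAC ltr_pdivrMr// ltr_pM2l// /s ltrDl.
have [h hF] := choice point.
have hu u : (fun f : rkhs Kp => ev f u) @ F --> ev h u.
  apply: cvg_big => [|p _]; first exact: add_continuous.
  by apply: cvgMl_tmp; exact: hF.
have hg (e : R) (g : rkhs Kp) : 0 < e ->
    F [set f : rkhs Kp | forall u, `|ev g u - ev f u| <= e * Num.sqrt (form K u u)] ->
    forall u, `|ev (h - (g : X -> R)) u| <= e * Num.sqrt (form K u u).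
  move=> e0 Fg u; rewrite (evD h (fun x => - g x)) evN distrC.
  have lim : (fun f : rkhs Kp => `|ev g u - ev f u|) @ F --> `|ev g u - ev h u|.
    by apply: cvg_norm; apply: cvgB; [exact: cvg_cst|exact: hu].
  by apply: (cvgr_to_le lim); apply: filterS Fg => f; exact.
have hH : in_rkhs K h.
  have [g Fg] := near_e 1 ltr01.
  rewrite -(subrK (g : X -> R) h); apply: (rkhsD Kp); last exact: rkhsP.
  by apply: (in_rkhs_bound Kp (ler01 : 0 <= 1)) => u; exact: hg.
have hP : h \in @rkhs_pred R X K by rewrite inE.
apply/cvg_ex; exists (Rkhs Kp hP); apply/cvgrPdist_le => e e0.
have e20 : 0 < e / 2 by exact: divr_gt0.
have [g Fg] := near_e _ e20.
have gh := hg _ _ e20 Fg; apply: filterS Fg => f gf.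
rewrite rkhs_normE; apply: (nrm_le Kp (ltW e0)) => u.
rewrite (evD h (fun x => - f x)) evN.
have -> : ev h u - ev f u = (ev h u - ev g u) + (ev g u - ev f u) by ring.
apply: (le_trans (ler_normD _ _)); rewrite [e]splitr mulrDl lerD//.
by have := gh u; rewrite (evD h (fun x => - g x)) evN.
Qed.

HB.instance Definition _ := Uniform_isComplete.Build (rkhs Kp) rkhs_complete.

Definition rkhs_hilbert : hilbert R :=
  @Hilbert R (rkhs Kp) (@rkhs_dot R X K Kp) rkhs_dotE.

End RKHSHilbert.

(** * Affine isometric actions from invariant kernels *)

Section GNS.
Context {R : realType} {L : preTopGroupType}.
Variable psi : L -> L -> R.
Hypothesis psi_cnd : cnd psi.
Hypothesis psi_diag : forall x, psi x x = 0.
Hypothesis psi_inv : forall g x y : L, psi (g * x)%g (g * y)%g = psi x y.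
Hypothesis mulg_cont_l : forall h : L, continuous (fun g : L => (h * g)%g).
Hypothesis mulg_cont_r : forall h : L, continuous (fun g : L => (g * h)%g).
Hypothesis psi_cont : (fun g : L => psi g 1%g) @ (1%g : L) --> (0 : R).

(** The Gram kernel of an embedding that sends [1] to the origin and whose
    squared distances are [psi]. *)
Definition gram (x y : L) : R := (psi x 1%g + psi y 1%g - psi x y) / 2.

(** Adding a multiple of the origin makes the coefficients sum to zero without
    changing the vector that [u] represents. *)
Definition centered (u : seq (R * L)) : seq (R * L) :=
  u ++ [:: (- ev (fun=> 1) u, 1%g)].

Lemma ev_centered f u : ev f (centered u) = ev f u - ev (fun=> 1) u * f 1%g.
Proof. by rewrite ev_cat ev1 mulNr. Qed.

Lemma ev1_centered u : ev (fun=> 1) (centered u) = 0.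
Proof. by rewrite ev_centered mulr1 subrr. Qed.

Lemma form_gram_zero_sum u : ev (fun=> 1) u = 0 ->
  form gram u u = - form psi u u / 2.
Proof.
move=> u0; rewrite (eq_form (L := fun x y =>
  (1 / 2) * (psi x 1%g) + ((1 / 2) * psi y 1%g + (- (1 / 2)) * psi x y))); last first.
  by move=> x y; rewrite /gram; field.
rewrite !formD !formZ form_left form_right u0; by field.
Qed.

Lemma gram1r x : gram x 1%g = 0.
Proof. by rewrite /gram psi_diag addr0 subrr mul0r. Qed.

Lemma gram_sym x y : gram x y = gram y x.
Proof. by rewrite /gram (psi_cnd.1 x y); congr (_ / _); ring. Qed.

Lemma form_gram_centered u : form gram (centered u) (centered u) = form gram u u.
Proof.
rewrite /form ev_centered.
rewrite (eq_ev (g := fun x => ev (gram x) u)) => [|x].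
  rewrite (eq_ev (g := fun=> 0) (centered _)) ?ev0 ?mulr0 ?subr0// => x.
  by rewrite gram_sym gram1r.
by rewrite ev_centered gram1r mulr0 subr0.
Qed.

Lemma gram_psd : psd gram.
Proof.
split=> [|u]; first exact: gram_sym.
rewrite -form_gram_centered form_gram_zero_sum ?ev1_centered//.
by rewrite divr_ge0// oppr_ge0 psi_cnd.2// ev1_centered.
Qed.

Definition translate (g : L) (u : seq (R * L)) : seq (R * L) :=
  [seq (p.1, (g * p.2)%g) | p <- u].

Lemma form_gram_translate g u :
  form gram (translate g (centered u)) (translate g (centered u)) = form gram u u.
Proof.
rewrite -(form_gram_centered u) !form_gram_zero_sum ?ev1_centered//; last first.
  by rewrite ev_map ev1_centered.
by rewrite form_map; congr (- _ / _); apply: eq_form => x y; rewrite psi_inv.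
Qed.

(** The formula is forced by [f z = <f, k_z>] and by the requirement that [g]
    sends [k_x - k_y] to [k_(g x) - k_(g y)], where [k_z] is the feature at [z]. *)
Definition lin_fun (g : L) (f : L -> R) : L -> R :=
  fun z => f (g^-1 * z)%g - f (g^-1)%g.

Lemma ev_lin_fun g f u :
  ev (lin_fun g f) u = ev f (translate g^-1%g (centered u)).
Proof.
rewrite ev_map ev_centered /= mulg1 /lin_fun.
rewrite (evD _ (fun=> - f g^-1%g)) -[in RHS]mulrN -evZr; congr (_ + _).
by apply: eq_ev => x; rewrite mul1r.
Qed.

(** [lin_fun g] acts on gains by permuting the combinations, so it is isometric. *)
Lemma gain_lin_fun g f u :
  gain gram (lin_fun g f) u = gain gram f (translate g^-1%g (centered u)).
Proof. by rewrite /gain ev_lin_fun form_gram_translate. Qed.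

Lemma lin_fun_rkhs g f : in_rkhs gram f -> in_rkhs gram (lin_fun g f).
Proof. by move=> [c fc]; exists c => u; rewrite gain_lin_fun. Qed.

Lemma sqn_lin_fun_le g f : in_rkhs gram f -> sqn gram (lin_fun g f) <= sqn gram f.
Proof. by move=> fH; apply: sqn_le => u; rewrite gain_lin_fun gain_le_sqn. Qed.

Lemma rkhs_base f : in_rkhs gram f -> f 1%g = 0.
Proof.
move=> fH; have := ev_le_nrm gram_psd [:: (1, 1%g)] fH.
by rewrite /form !ev1 !mul1r gram1r sqrtr0 mulr0 normr_le0 => /eqP.
Qed.

Lemma lin_funM g h f : lin_fun g (lin_fun h f) = lin_fun (g * h)%g f.
Proof.
apply/funext => z; rewrite /lin_fun invgM mulgA; ring.
Qed.

Lemma lin_fun1 f : in_rkhs gram f -> lin_fun 1%g f = f.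
Proof.
by move=> fH; apply/funext => z; rewrite /lin_fun invg1 mul1g rkhs_base// subr0.
Qed.

Lemma nrm_lin_fun g f : in_rkhs gram f -> nrm gram (lin_fun g f) = nrm gram f.
Proof.
move=> fH; rewrite /nrm; congr Num.sqrt; apply/eqP.
rewrite eq_le sqn_lin_fun_le//= -{1}[f](lin_fun1 fH) -(mulVg g) -lin_funM.
by apply: sqn_lin_fun_le; exact: lin_fun_rkhs.
Qed.

Let V := rkhs gram_psd.

Lemma lin_fun_pred g (f : V) : lin_fun g f \in @rkhs_pred R L gram.
Proof. by rewrite inE; apply: lin_fun_rkhs; exact: rkhsP. Qed.

Definition lin_part (g : L) (f : V) : V := Rkhs gram_psd (lin_fun_pred g f).

Lemma lin_part_linear g : linear (lin_part g).
Proof.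
move=> a f h; apply/val_inj/funext => z.
change ((a * f (g^-1 * z)%g + h (g^-1 * z)%g) - (a * f (g^-1)%g + h (g^-1)%g) =
  a * (f (g^-1 * z)%g - f (g^-1)%g) + (h (g^-1 * z)%g - h (g^-1)%g)).
by ring.
Qed.

HB.instance Definition _ g :=
  GRing.isLinear.Build R V V _ (lin_part g) (lin_part_linear g).

Lemma norm_lin_part g (f : V) : `|lin_part g f| = `|f|.
Proof. by rewrite rkhs_normE /= nrm_lin_fun//; exact: rkhsP. Qed.

Lemma feature_pred u : feature gram u \in @rkhs_pred R L gram.
Proof. by rewrite inE; exact: (rkhs_feature gram_psd). Qed.

Definition vect (u : seq (R * L)) : V := Rkhs gram_psd (feature_pred u).

Definition orbit_pt (g : L) : V := vect [:: (1, g)].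

Lemma orbit_ptE g z : orbit_pt g z = gram z g.
Proof. by rewrite /= /feature ev1 mul1r. Qed.

Lemma vect_cons a x u : vect ((a, x) :: u) = a *: orbit_pt x + vect u.
Proof.
apply/val_inj/funext => z.
rewrite -[RHS]/(a * orbit_pt x z + feature gram u z) orbit_ptE.
by rewrite -[LHS]/(feature gram _ z) /feature ev_cons.
Qed.

Lemma norm_vect u : `|vect u| ^+ 2 = form gram u u.
Proof.
rewrite rkhs_normE (sqr_nrm (rkhsP (vect u))).
exact: (sqn_feature1 gram_psd).
Qed.

Lemma lin_part_orbit g x : lin_part g (orbit_pt x) = orbit_pt (g * x)%g - orbit_pt g.
Proof.
apply/val_inj/funext => z.
rewrite -[RHS]/(orbit_pt (g * x)%g z - orbit_pt g z).
rewrite -[LHS]/(orbit_pt x (g^-1 * z)%g - orbit_pt x (g^-1)%g).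
rewrite !orbit_ptE /gram -(psi_inv g (g^-1 * z)%g x) -(psi_inv g (g^-1 * z)%g 1%g).
rewrite -(psi_inv g g^-1%g x) -(psi_inv g g^-1%g 1%g) mulVKg mulgV mulg1.
rewrite (psi_cnd.1 1%g (g * x)%g) (psi_cnd.1 1%g g); by field.
Qed.

Definition gns (g : L) (f : V) : V := lin_part g f + orbit_pt g.

Lemma orbit_pt1 : orbit_pt 1%g = 0.
Proof.
by apply/val_inj/funext => z; rewrite -[LHS]/(orbit_pt 1%g z) orbit_ptE gram1r.
Qed.

Lemma gns_action : @is_action R L (rkhs_hilbert gram_psd) gns.
Proof.
split=> [f|g h f]; rewrite /gns.
  rewrite orbit_pt1 addr0; apply/val_inj => /=.
  by apply: lin_fun1; exact: rkhsP.
rewrite raddfD /= lin_part_orbit -!addrA addNr addr0; congr (_ + _).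
by apply/val_inj => /=; rewrite lin_funM.
Qed.

Lemma gns_affine g : @is_affine R (rkhs_hilbert gram_psd) (gns g).
Proof. by exists (lin_part g), (orbit_pt g). Qed.

Lemma gns_dist g f h : `|gns g f - gns g h| = `|f - h|.
Proof. by rewrite /gns opprD addrACA subrr addr0 -raddfB norm_lin_part. Qed.

Lemma norm_gns0 g : `|gns g 0| ^+ 2 = psi g 1%g.
Proof.
rewrite /gns raddf0 add0r norm_vect /form !ev1 /gram psi_diag.
by rewrite !mul1r; field.
Qed.

Lemma norm_orbitB g h : `|orbit_pt g - orbit_pt h| ^+ 2 = psi g h.
Proof.
have -> : orbit_pt g - orbit_pt h = vect [:: (1, g); (-1, h)].
  rewrite vect_cons scale1r vect_cons scaleN1r (_ : vect [::] = 0) ?addr0//.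
  by apply/val_inj/funext => z; rewrite /= /feature ev_nil.
rewrite norm_vect /form !ev_cons !ev_nil /= /gram !psi_diag (psi_cnd.1 h g).
by field.
Qed.

Lemma orbit_pt_continuous : continuous orbit_pt.
Proof.
move=> h; apply/cvgrPdist_lt => e e0.
have tr : (h^-1 * g)%g @[g --> h] --> (1%g : L).
  by rewrite -(mulVg h); exact: mulg_cont_l.
have /cvgrPdist_lt/(_ _ (exprn_gt0 2 e0)) := cvg_comp _ _ tr psi_cont.
apply: filterS => g /=; rewrite sub0r normrN -(psi_inv h) mulVKg mulg1.
rewrite (psi_cnd.1) -norm_orbitB ger0_norm ?sqr_ge0//.
by rewrite ltr_pXn2r ?nnegrE ?normr_ge0 ?ltW.
Qed.

(** The operators are isometric, so continuity of the orbit map at [f] follows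
    from continuity at approximations of [f]; on features it is that of [psi]. *)
Lemma lin_part_continuous f : continuous (fun g => lin_part g f).
Proof.
have vect_continuous u : continuous (fun g => lin_part g (vect u)).
  elim: u => [|[a x] u IHu].
    rewrite (_ : vect [::] = 0).
      by under eq_fun do rewrite raddf0; move=> h; exact: cvg_cst.
    by apply/val_inj/funext => z; rewrite /= /feature ev_nil.
  rewrite (_ : (fun g => _) = fun g =>
      a *: (orbit_pt (g * x)%g - orbit_pt g) + lin_part g (vect u)); last first.
    by apply/funext => g; rewrite vect_cons linearP /= lin_part_orbit.
  move=> h; apply: cvgD; last exact: IHu.
  apply: cvgZl_tmp; apply: cvgB; last exact: orbit_pt_continuous.
  apply: (cvg_comp (fun g => (g * x)%g) orbit_pt); first exact: mulg_cont_r.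
  exact: orbit_pt_continuous.
move=> h; apply/cvgrPdist_lt => e e0.
have e30 : 0 < e / 3 by exact: divr_gt0.
have [u fu] := feature_dense gram_psd e30 (rkhsP f).
have {}fu : `|f - vect u| <= e / 3 by [].
have /cvgrPdist_lt/(_ _ e30) := vect_continuous u h.
apply: filterS => g ug.
have -> : lin_part h f - lin_part g f = lin_part h (f - vect u) +
    (lin_part h (vect u) - lin_part g (vect u)) - lin_part g (f - vect u).
  by rewrite (raddfB (lin_part h)) (raddfB (lin_part g)) addrA subrK opprB addrA subrK.
rewrite (_ : e = e / 3 + e / 3 + e / 3); last by field.
apply: (le_lt_trans (ler_normB _ _)); rewrite norm_lin_part ltr_leD//.
by apply: (le_lt_trans (ler_normD _ _)); rewrite norm_lin_part ler_ltD.
Qed.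

Lemma gns_orbit_continuous f : continuous (fun g => gns g f).
Proof.
by move=> h; apply: cvgD; [exact: lin_part_continuous|exact: orbit_pt_continuous].
Qed.

Lemma gns_ball_closed f r : closed [set g | `|gns g f| <= r].
Proof.
apply: (preimage_closed (f := fun g => `|gns g f|) (D := [set x | x <= r])) => [g _|].
  by apply: cvg_norm; exact: gns_orbit_continuous.
exact: closed_le.
Qed.

Lemma gns_continuous : continuous (fun p : L * V => gns p.1 p.2).
Proof.
move=> [h f]; apply/cvgrPdist_lt => e e0.
have e20 : 0 < e / 2 by exact: divr_gt0.
have /cvgrPdist_lt/(_ _ e20) A := @gns_orbit_continuous f h.
have /cvgrPdist_lt/(_ _ e20) B := @cvg_id _ (nbhs f).
exists ([set g | `|gns h f - gns g f| < e / 2], [set k : V | `|f - k| < e / 2]).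
  by split.
move=> [g k] [/= gA kB].
rewrite -(subrK (gns g f) (gns h f)) -addrA [e]splitr.
by apply: (le_lt_trans (ler_normD _ _)); rewrite gns_dist ltrD.
Qed.

Lemma gns_affine_isometric_action :
  @affine_isometric_action R L (rkhs_hilbert gram_psd) gns.
Proof.
split; [exact: gns_action|exact: gns_affine|exact: gns_dist|].
exact: gns_continuous.
Qed.

End GNS.

(** * HNN extensions *)

Section HNNAlgebra.
Variables (H : Type) (G : preTopGroupType) (i1 i2 : H -> G).
Local Notation Gam := (hnn i1 i2).
Local Notation base := (@hnn_base H G i1 i2).
Local Notation t := (hnn_stable i1 i2).
Local Notation class := (presented_class (hnn_rel i1 i2)).

Lemma class_cat u v : class (u ++ v) = (class u * class v)%g :> Gam.
Proof. by rewrite -[RHS]/(pmul _ _) pmulE. Qed.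

Lemma class_cong u v : word_cong (hnn_rel i1 i2) u v -> class u = class v :> Gam.
Proof. by move=> uv; apply/presented_classP/asboolP. Qed.

Lemma class_inv s : class [:: (s, true)] = (class [:: (s, false)])^-1%g :> Gam.
Proof.
apply: (mulgI (class [:: (s, false)] : Gam)); rewrite mulgV -class_cat.
by apply: class_cong; exact: word_cong_cancel.
Qed.

Lemma hnn_baseM g g' : base (g * g')%g = (base g * base g')%g.
Proof.
rewrite -[RHS]class_cat; apply/esym/class_cong/word_cong_rel; exact: hnn_rel_mul.
Qed.

Lemma hnn_base1 : base 1%g = 1%g.
Proof. by apply: (mulgI (base 1%g)); rewrite -hnn_baseM !mulg1. Qed.

Lemma hnn_baseV g : base g^-1%g = (base g)^-1%g.
Proof. by apply: (mulgI (base g)); rewrite -hnn_baseM !mulgV hnn_base1. Qed.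

Lemma hnn_conj h : (t * base (i1 h) * t^-1)%g = base (i2 h).
Proof.
rewrite -mulgA -class_inv -(class_cat [:: _] [:: _]) -class_cat.
apply: class_cong.
by apply: word_cong_rel; constructor.
Qed.

Lemma hnn_ind (P : Gam -> Prop) : P 1%g ->
  (forall g x, P x -> P (base g * x)%g) ->
  (forall x, P x -> P (t * x)%g) ->
  (forall x, P x -> P (t^-1 * x)%g) -> forall x, P x.
Proof.
move=> P1 Pg Pt PtV; elim/presented_ind => w.
elim: w => [//|[[g|] b] w IHw]; rewrite -cat1s class_cat; last first.
  by case: b; rewrite ?class_inv; [exact: PtV|exact: Pt].
case: b; rewrite ?class_inv; last exact: Pg.
by rewrite -[X in (X^-1)%g]/(base g) -hnn_baseV; exact: Pg.
Qed.

(** The universal property of the extension, stated for actions on a set: maps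
    [tau] and [tauV] satisfying the relations extend an action of [G]. *)
Section Action.
Variables (X : Type) (a : G -> X -> X) (tau tauV : X -> X).
Hypothesis a1 : forall x, a 1%g x = x.
Hypothesis aM : forall g g' x, a (g * g')%g x = a g (a g' x).
Hypothesis tauK : cancel tau tauV.
Hypothesis tauVK : cancel tauV tau.
Hypothesis tau_conj : forall h x, tau (a (i1 h) (tauV x)) = a (i2 h) x.

Definition letter_act (l : option G * bool) : X -> X :=
  match l with
  | (Some g, false) => a g
  | (Some g, true) => a g^-1%g
  | (None, false) => tau
  | (None, true) => tauV
  end.

Definition word_act (w : word (option G)) (x : X) : X := foldr letter_act x w.

Lemma word_act_cat u v x : word_act (u ++ v) x = word_act u (word_act v x).
Proof. exact: foldr_cat. Qed.

Lemma word_act_cong u v : word_cong (hnn_rel i1 i2) u v -> word_act u =1 word_act v.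
Proof.
elim=> {u v} [//|u v _ uv x|u v w _ uv _ vw x|u u' v v' _ uu' _ vv' x|s b x|u v].
- by rewrite uv.
- by rewrite uv.
- by rewrite !word_act_cat vv' uu'.
- case: s b => [g|] [] /=; rewrite ?tauK ?tauVK -?aM ?mulgV ?mulVg ?a1 //.
case=> [g g'|h] x /=; by rewrite ?aM// tau_conj.
Qed.

Definition hnn_act (x : Gam) : X -> X := word_act (repr x).

Lemma hnn_act_class w x : hnn_act (class w) x = word_act w x.
Proof. exact/word_act_cong/repr_cong. Qed.

Lemma hnn_act1 x : hnn_act 1%g x = x.
Proof. exact: (hnn_act_class [::]). Qed.

Lemma hnn_actM y z x : hnn_act (y * z)%g x = hnn_act y (hnn_act z x).
Proof.
elim/presented_ind: y => u; elim/presented_ind: z => v.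
by rewrite -class_cat !hnn_act_class word_act_cat.
Qed.

Lemma hnn_act_base g x : hnn_act (base g) x = a g x.
Proof. exact: hnn_act_class. Qed.

Lemma hnn_act_stable x : hnn_act t x = tau x.
Proof. exact: hnn_act_class. Qed.

Lemma hnn_act_stableV x : hnn_act t^-1%g x = tauV x.
Proof. by rewrite -class_inv hnn_act_class. Qed.

End Action.
End HNNAlgebra.

Section TopGroupTheory.
Context {L : topGroupType}.

Lemma mulg_continuous_l (h : L) : continuous (fun g : L => (h * g)%g).
Proof.
move=> g; apply: (@continuous2_cvg _ _ _ _ _ _ (fun=> h) id (fun x y => x * y)%g).
- exact: (mulg_continuous (h, g)).
- exact: cvg_cst.
- exact: cvg_id.
Qed.

Lemma mulg_continuous_r (h : L) : continuous (fun g : L => (g * h)%g).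
Proof.
move=> g; apply: (@continuous2_cvg _ _ _ _ _ _ id (fun=> h) (fun x y => x * y)%g).
- exact: (mulg_continuous (g, h)).
- exact: cvg_id.
- exact: cvg_cst.
Qed.

End TopGroupTheory.

Section HNNTopology.
Variables (H : Type) (G : preTopGroupType) (i1 i2 : H -> G).
Local Notation Gam := (hnn i1 i2).
Local Notation base := (@hnn_base H G i1 i2).

Lemma hnn_prebasis_open (A : set Gam) : hnn_prebasis A -> open A.
Proof.
move=> pA; exists [set A]; last first.
  by rewrite predeqE => x; split=> [[_ ->]|Ax] //; exists A.
move=> _ ->; exact: (@finI_from1 _ _ _ id A pA).
Qed.

Lemma cvg_hnn (F : set_system Gam) {FF : Filter F} (x : Gam) :
  (forall A, hnn_prebasis A -> A x -> F A) -> F --> x.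
Proof.
move=> FA A; rewrite /= (@nbhsE Gam).
move=> [_ [[B sB <-] [C BC Cx] sUBA]].
rewrite nbhs_filterE; apply: filterS sUBA _; apply: (@filterS _ _ _ C).
  by move=> ? ?; exists C.
have /sB [D sD IDeC] := BC; rewrite -IDeC; apply: filter_bigI => E DE.
have /sD/set_mem pE := DE; apply: FA => //.
by move: Cx; rewrite -IDeC => /(_ _ DE).
Qed.

Lemma hnn_prebasis_translate (A : set Gam) y z : hnn_prebasis A ->
  hnn_prebasis [set x | A (y * x * z)%g].
Proof.
move=> [a [b [U [oU ->]]]].
exists (y^-1 * a)%g, (b * z^-1)%g, U; split=> //.
apply/seteqP; split=> [x [u Uu e]|_ [u Uu <-]]; exists u => //.
  by rewrite -(mulKg y x) -(mulgK z (y * x)%g) -e !mulgA.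
by rewrite !mulgA mulgVK mulgV mul1g.
Qed.

Lemma hnn_translate_continuous (y z : Gam) : continuous (fun x : Gam => (y * x * z)%g).
Proof.
move=> x; apply: cvg_hnn => [|A pA Ax]; first exact/fmap_filter/nbhs_filter.
apply: open_nbhs_nbhs; split => //.
exact/hnn_prebasis_open/hnn_prebasis_translate.
Qed.

Lemma nbhs1_hnn_base (U : set G) : open U -> U 1%g -> nbhs (1%g : Gam) (base @` U).
Proof.
move=> oU U1; apply: open_nbhs_nbhs; split; last by exists 1%g => //; exact: hnn_base1.
apply: hnn_prebasis_open; exists 1%g, 1%g, U; split => //.
by apply/seteqP; split=> _ [u Uu <-]; exists u => //; rewrite mul1g mulg1.
Qed.

End HNNTopology.

Section HNNBaseContinuous.
Variables (H G : topGroupType) (i1 i2 : H -> G).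
Hypothesis i1_incl : is_inclusion i1.
Hypothesis i1_open : open (range i1).
Hypothesis i2_incl : is_inclusion i2.
Hypothesis i2_open : open (range i2).
Local Notation Gam := (hnn i1 i2).
Local Notation base := (@hnn_base H G i1 i2).
Local Notation t := (hnn_stable i1 i2).

Lemma inclusion1 (L M : preTopGroupType) (f : L -> M) : is_inclusion f -> f 1%g = 1%g.
Proof. by move=> [fM _ _ _]; apply: (mulgI (f 1%g)); rewrite -fM !mulg1. Qed.

Lemma inclusion_open (L M : preTopGroupType) (f : L -> M) (U : set L) :
  is_inclusion f -> open (range f) -> open U -> open (f @` U).
Proof. by move=> [_ _ _ fo] of1 /fo [V oV ->]; exact: openI. Qed.

(** The neighbourhoods of [1] in [G] generate a family that is stable under
    conjugation in the extension; for the stable letter, the part of [U] inside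
    the first subgroup is moved onto an open subset of the second one. *)
Lemma hnn_conj_nbhs (x : Gam) (U : set G) : open U -> U 1%g ->
  exists W : set G, [/\ open W, W 1%g &
    forall w, W w -> exists2 u, U u & base w = (x * base u * x^-1)%g].
Proof.
elim/hnn_ind: x U => [|g x IHx|x IHx|x IHx] U oU U1.
- by exists U; split=> // w Uw; exists w => //; rewrite mul1g invg1 mulg1.
- have [W [oW W1 WU]] := IHx _ oU U1.
  exists ((fun w => g^-1 * w * g)%g @^-1` W); split.
  + apply: open_comp => // w _.
    apply: (@cvg_comp _ _ _ (fun w : G => (g^-1 * w)%g) (fun w => (w * g)%g)).
      exact: (mulg_continuous_l).
    exact: mulg_continuous_r.
  + by rewrite /= mulg1 mulVg.
  + move=> w /= /WU[u Uu wu]; exists u => //.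
    rewrite invgM !mulgA -(mulgA _ x) -(mulgA _ (x * _)%g) -wu.
    by rewrite -!hnn_baseV -!hnn_baseM !mulgA mulgV mul1g mulgK.
- have [W [oW W1 WU]] := IHx _ oU U1.
  exists (i2 @` (i1 @^-1` W)); split.
  + apply: inclusion_open => //; apply: open_comp => // h _.
    by case: i1_incl => _ _ c _; exact: c.
  + by exists 1%g; rewrite /= ?inclusion1.
  + move=> _ [h /= /WU[u Uu wu] <-]; exists u => //.
    by rewrite -hnn_conj wu invgM !mulgA.
- have [W [oW W1 WU]] := IHx _ oU U1.
  exists (i1 @` (i2 @^-1` W)); split.
  + apply: inclusion_open => //; apply: open_comp => // h _.
    by case: i2_incl => _ _ c _; exact: c.
  + by exists 1%g; rewrite /= ?inclusion1.
  + move=> _ [h /= /WU[u Uu wu] <-]; exists u => //.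
    rewrite invgM invgK -!mulgA (mulgA x) (mulgA (x * _)%g) -wu -hnn_conj.
    by rewrite !mulgA mulVg mul1g mulgVK.
Qed.

(** A basic open set around [base g] is a two-sided translate of an open subset
    of [G]; after translation to [1] it is a conjugate of a neighbourhood. *)
Lemma hnn_base_continuous : continuous base.
Proof.
move=> g; apply: cvg_hnn => _ [x [y [U [oU ->]]]] [u0 Uu0 eg].
have oV : open ((fun u => (u * u0)%g) @^-1` U).
  by apply: open_comp => // w _; exact: mulg_continuous_r.
have V1 : ((fun u => (u * u0)%g) @^-1` U) 1%g by rewrite /= mul1g.
have [W [oW W1 WV]] := hnn_conj_nbhs x oV V1.
have : nbhs g ((fun k => (k * g^-1)%g) @^-1` W).
  apply: open_nbhs_nbhs; split; last by rewrite /= mulgV.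
  by apply: open_comp => // w _; exact: mulg_continuous_r.
apply: filterS => k /= /WV[u /= Uu e].
exists (u * u0)%g => //.
rewrite hnn_baseM mulgA -(mulgVK g k) hnn_baseM e -eg !mulgA.
by rewrite mulgVK.
Qed.

End HNNBaseContinuous.

(** * The Bass-Serre tree *)

Section Tree.
Context {R : realType} (H : groupType) (G : preTopGroupType) (i1 i2 : H -> G).
Hypothesis i1M : {morph i1 : x y / (x * y)%g}.
Local Notation Gam := (hnn i1 i2).
Local Notation base := (@hnn_base H G i1 i2).
Local Notation t := (hnn_stable i1 i2 : Gam).

(** Edges of the Bass-Serre tree are the left cosets of the image of [i1], taken
    as sets; vertices are the left cosets of [G]. The edge [edge x] joins the
    vertices of [x] and of [x t^-1], since [i1 h] fixes both [G] and [t^-1 G]. *)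
Definition edge (x : Gam) : set Gam := [set y | exists h, y = (x * base (i1 h))%g].

Definition edge_dirac (x : Gam) : set Gam -> R := fun e => `[< e = edge x >]%:R.

Definition translate_chain (x : Gam) (f : set Gam -> R) : set Gam -> R :=
  fun e => f [set y | e (x * y)%g].

Lemma translate_chainM x y f :
  translate_chain (x * y)%g f = translate_chain x (translate_chain y f).
Proof.
apply/funext => e; rewrite /translate_chain /=; congr f.
by apply/funext => z /=; rewrite mulgA.
Qed.

Lemma translate_chain1 f : translate_chain 1%g f = f.
Proof.
apply/funext => e; rewrite /translate_chain; congr f.
by apply/funext => z /=; rewrite mul1g.
Qed.

Lemma translate_chainD x f g :
  translate_chain x (f + g) = translate_chain x f + translate_chain x g.
Proof. by []. Qed.

Lemma translate_chainN x f : translate_chain x (- f) = - translate_chain x f.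
Proof. by []. Qed.

Lemma translate_edge x y : [set z | edge y (x * z)%g] = edge (x^-1 * y)%g.
Proof.
apply/seteqP; split=> z [h e]; exists h.
  by rewrite -mulgA -e mulKg.
by rewrite e -mulgA mulVKg.
Qed.

Lemma translate_dirac x y :
  translate_chain x (edge_dirac y) = edge_dirac (x * y)%g.
Proof.
apply/funext => e; rewrite /translate_chain /edge_dirac; congr (nat_of_bool _)%:R.
apply/asboolP/asboolP => [ex|->]; last by rewrite translate_edge mulKg.
rewrite -[y in RHS](mulKg x) in ex *.
move: ex; rewrite -translate_edge => /seteqP[le ge]; apply/seteqP; split=> z.
  by move=> ez; rewrite -[z](mulVKg x); apply: le; rewrite /= mulVKg.
by move=> ez; rewrite -[z](mulVKg x); apply: ge; rewrite /= mulVKg.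
Qed.

Lemma i1_1 : i1 1%g = 1%g.
Proof. by apply: (mulgI (i1 1%g)); rewrite -i1M !mulg1. Qed.

Lemma edge_i1 x h : edge (x * base (i1 h))%g = edge x.
Proof.
apply/seteqP; split=> _ [k ->].
  by exists (h * k)%g; rewrite i1M hnn_baseM mulgA.
exists (h^-1 * k)%g; rewrite -mulgA -hnn_baseM -i1M mulgA mulgV mul1g //.
Qed.

Lemma edge_inj x y : edge x = edge y -> exists h, x = (y * base (i1 h))%g.
Proof.
move=> xy; have : edge x x by exists 1%g; rewrite i1_1 hnn_base1 mulg1.
by rewrite xy.
Qed.

Lemma stable_i1 h : (t * base (i1 h))%g = (base (i2 h) * t)%g.
Proof. by rewrite -hnn_conj mulgVK. Qed.

Lemma stableV_i2 h : (t^-1 * base (i2 h))%g = (base (i1 h) * t^-1)%g.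
Proof. by rewrite -hnn_conj -mulgA mulKg. Qed.

Definition base_chain (g : G) (f : set Gam -> R) := translate_chain (base g) f.
Definition stable_chain (f : set Gam -> R) := translate_chain t f + edge_dirac t.
Definition stableV_chain (f : set Gam -> R) :=
  translate_chain t^-1%g (f - edge_dirac t).

Lemma base_chain1 f : base_chain 1%g f = f.
Proof. by rewrite /base_chain hnn_base1 translate_chain1. Qed.

Lemma base_chainM g g' f : base_chain (g * g')%g f = base_chain g (base_chain g' f).
Proof. by rewrite /base_chain hnn_baseM translate_chainM. Qed.

Lemma stable_chainK : cancel stable_chain stableV_chain.
Proof.
move=> f; rewrite /stableV_chain /stable_chain addrK.
by rewrite -translate_chainM mulVg translate_chain1.
Qed.

Lemma stableV_chainK : cancel stableV_chain stable_chain.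
Proof.
move=> f; rewrite /stableV_chain /stable_chain.
by rewrite -translate_chainM mulgV translate_chain1 subrK.
Qed.

Lemma stable_chain_conj h f :
  stable_chain (base_chain (i1 h) (stableV_chain f)) = base_chain (i2 h) f.
Proof.
rewrite /stable_chain /stableV_chain /base_chain -!translate_chainM hnn_conj.
rewrite translate_chainD translate_chainN translate_dirac -stable_i1.
by rewrite /edge_dirac edge_i1 subrK.
Qed.

(** The chain of edges on the path from the base vertex [G] to [x G]. It is
    defined by the universal property, as the orbit of [0] under an affine action
    in which [G] acts linearly and the stable letter adds the edge that it
    crosses. *)
Definition path_chain (x : Gam) : set Gam -> R :=
  @hnn_act H G i1 i2 _ base_chain stable_chain stableV_chain x 0.

Local Notation act := (@hnn_act H G i1 i2 _ base_chain stable_chain stableV_chain).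

Lemma actM x y f : act (x * y)%g f = act x (act y f).
Proof.
apply: hnn_actM;
  [exact: base_chain1|exact: base_chainM|exact: stable_chainK|
   exact: stableV_chainK|exact: stable_chain_conj].
Qed.

Lemma act_base g f : act (base g) f = base_chain g f.
Proof.
apply: hnn_act_base;
  [exact: base_chain1|exact: base_chainM|exact: stable_chainK|
   exact: stableV_chainK|exact: stable_chain_conj].
Qed.

Lemma act_stable f : act t f = stable_chain f.
Proof.
apply: hnn_act_stable;
  [exact: base_chain1|exact: base_chainM|exact: stable_chainK|
   exact: stableV_chainK|exact: stable_chain_conj].
Qed.

Lemma act_stableV f : act t^-1%g f = stableV_chain f.
Proof.
apply: hnn_act_stableV;
  [exact: base_chain1|exact: base_chainM|exact: stable_chainK|
   exact: stableV_chainK|exact: stable_chain_conj].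
Qed.

Lemma act1 f : act 1%g f = f.
Proof. by rewrite -hnn_base1 act_base base_chain1. Qed.

Lemma act_affine x f : act x f = translate_chain x f + path_chain x.
Proof.
rewrite /path_chain; elim/hnn_ind: x f => [|g x IHx|x IHx|x IHx] f.
- by rewrite !act1 translate_chain1 addr0.
- by rewrite !actM !act_base /base_chain IHx translate_chainD translate_chainM.
- by rewrite !actM !act_stable /stable_chain IHx translate_chainD translate_chainM addrA.
- by rewrite !actM !act_stableV /stableV_chain IHx !translate_chainD translate_chainM addrA.
Qed.

Lemma path_chainM x y :
  path_chain (x * y)%g = translate_chain x (path_chain y) + path_chain x.
Proof. by rewrite -act_affine /path_chain actM. Qed.

Lemma path_chain_base g : path_chain (base g) = 0.
Proof. by rewrite /path_chain act_base. Qed.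

Lemma translate_chain0 x : translate_chain x 0 = 0.
Proof. by []. Qed.

Lemma path_chain_stable : path_chain t = edge_dirac t.
Proof. by rewrite /path_chain act_stable /stable_chain translate_chain0 add0r. Qed.

Lemma path_chain_stableV : path_chain t^-1%g = - edge_dirac 1%g.
Proof.
rewrite /path_chain act_stableV /stableV_chain sub0r translate_chainN.
by rewrite translate_dirac mulVg.
Qed.

Lemma path_chain_up x g :
  path_chain (x * t * base g)%g = path_chain x + edge_dirac (x * t)%g.
Proof.
rewrite path_chainM path_chain_base translate_chain0 add0r path_chainM.
by rewrite path_chain_stable translate_dirac addrC.
Qed.

Lemma path_chain_down x g :
  path_chain (x * t^-1 * base g)%g = path_chain x - edge_dirac x.
Proof.
rewrite path_chainM path_chain_base translate_chain0 add0r path_chainM.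
by rewrite path_chain_stableV translate_chainN translate_dirac mulg1 addrC.
Qed.

(** Words with [n] stable letters, equivalently walks of length [n] from the base
    vertex. *)
Fixpoint reach (n : nat) (x : Gam) : Prop :=
  match n with
  | 0 => exists g, x = base g
  | n'.+1 => exists y g, reach n' y /\
      (x = (y * t * base g)%g \/ x = (y * t^-1 * base g)%g)
  end.

Lemma reach_base n x g : reach n x -> reach n (x * base g)%g.
Proof.
case: n => [[k ->]|n [y [k [yn xy]]]]; first by exists (k * g)%g; rewrite hnn_baseM.
exists y, (k * g)%g; split=> //.
by case: xy => ->; [left|right]; rewrite hnn_baseM mulgA.
Qed.

Lemma reach_base_left n x g : reach n x -> reach n (base g * x)%g.
Proof.
elim: n x => [x [k ->]|n IHn x [y [k [yn xy]]]].
  by exists (g * k)%g; rewrite hnn_baseM.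
exists (base g * y)%g, k; split; first exact: IHn.
by case: xy => ->; [left|right]; rewrite !mulgA.
Qed.

Lemma reach_stable_left (s : Gam) n x : s = t \/ s = t^-1%g ->
  reach n x -> reach n.+1 (s * x)%g.
Proof.
move=> st; elim: n x => [x [k ->]|n IHn x [y [k [yn xy]]]].
  exists 1%g, k; split; first by exists 1%g; rewrite hnn_base1.
  by case: st => ->; [left|right]; rewrite mul1g.
exists (s * y)%g, k; split; first exact: IHn.
by case: xy => ->; [left|right]; rewrite !mulgA.
Qed.

Lemma reach_total x : exists n, reach n x.
Proof.
elim/hnn_ind: x => [|g x [n xn]|x [n xn]|x [n xn]].
- by exists 0, 1%g; rewrite hnn_base1.
- by exists n; exact: reach_base_left.
- by exists n.+1; apply: reach_stable_left xn; left.
- by exists n.+1; apply: reach_stable_left xn; right.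
Qed.

Definition ball_tree (n : nat) (x : Gam) := exists2 m, (m <= n)%N & reach m x.

(** Edges with both endpoints within distance [n] of the base vertex. *)
Definition low_edge (n : nat) (e : set Gam) : Prop :=
  exists x, [/\ e = edge x, ball_tree n x & ball_tree n (x * t^-1)%g].

Lemma ball_tree_base n x g : ball_tree n x -> ball_tree n (x * base g)%g.
Proof. by move=> [m mn xm]; exists m => //; exact: reach_base. Qed.

Lemma low_edgeP n x : low_edge n (edge x) -> ball_tree n x /\ ball_tree n (x * t^-1)%g.
Proof.
move=> [y [/edge_inj[h ->] yn ytn]]; split; first exact: ball_tree_base.
by rewrite -mulgA -stableV_i2 mulgA; exact: ball_tree_base.
Qed.

Lemma ball_tree_baseV n x g : ball_tree n (x * base g)%g -> ball_tree n x.
Proof.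
move=> /(ball_tree_base g^-1%g); rewrite -mulgA -hnn_baseM mulgV hnn_base1.
by rewrite mulg1.
Qed.

Lemma low_edgeS n e : low_edge n e -> low_edge n.+1 e.
Proof.
by move=> [x [-> [m mn xm] [k kn xk]]]; exists x; split=> //;
  [exists m => //; exact: leqW|exists k => //; exact: leqW].
Qed.

(** A path chain changes by [1] in absolute value across an edge. Along a
    shortest path the farthest endpoint of the new edge is farther away than all
    earlier vertices, so the edge is new and the squared norm of the chain is the
    length of the path. *)
Lemma path_chain_norm n x : reach n x -> (forall m, (m < n)%N -> ~ reach m x) ->
  [/\ forall e, path_chain x e != 0 -> low_edge n e,
      exists s : seq (set Gam), forall e, path_chain x e != 0 -> e \in s &
      forall s : seq (set Gam), uniq s ->
        (forall e, path_chain x e != 0 -> e \in s) ->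
        \sum_(e <- s) path_chain x e ^+ 2 = n%:R].
Proof.
elim: n x => [x [g ->] _|n IHn x [y [g [yn xy]]] xmin].
  rewrite path_chain_base; split=> [e|| s us se]; rewrite ?eqxx//.
    by exists [::] => e; rewrite eqxx.
  by rewrite big1// => e _; rewrite expr0n.
have xn : ~ ball_tree n x by move=> [m mn]; apply: xmin; rewrite ltnS.
have ymin m : (m < n)%N -> ~ reach m y.
  move=> mn ym; apply: (xmin m.+1); first by rewrite ltnS.
  by exists y, g.
have [low [s0 cov0] sum] := IHn y yn ymin.
have [z [a [a1 Ex zlow znew]]] : exists z, exists a : R, [/\ a ^+ 2 = 1,
    path_chain x = path_chain y + (fun e => a * edge_dirac z e),
    low_edge n.+1 (edge z) & ~ low_edge n (edge z)].
  have yb : ball_tree n.+1 y by exists n.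
  have xb : ball_tree n.+1 x by exists n.+1 => //; exists y, g.
  case: xy => Ex; rewrite Ex in xn xb *.
    exists (y * t)%g, 1; split; rewrite ?expr1n//.
    + rewrite path_chain_up; congr (_ + _).
      by apply/funext => e; rewrite mul1r.
    + exists (y * t)%g; split=> //; last by rewrite mulgK.
      exact: ball_tree_baseV xb.
    + by move=> /low_edgeP[yt _]; apply: xn; exact: ball_tree_base.
  exists y, (-1); split; rewrite ?sqrrN ?expr1n//.
  + rewrite path_chain_down; congr (_ + _).
    by apply/funext => e; rewrite mulN1r.
  + by exists y; split=> //; exact: ball_tree_baseV xb.
  + by move=> /low_edgeP[_ yt]; apply: xn; exact: ball_tree_base.
have yz : path_chain y (edge z) = 0.
  by apply/eqP/negPn/negP => /low.
have a0 : a != 0 by rewrite -sqrf_eq0 a1 oner_neq0.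
have xz : path_chain x (edge z) = a.
  rewrite Ex -[LHS]/(_ + a * edge_dirac z (edge z)) yz add0r /edge_dirac.
  by rewrite (asboolT (erefl _)) mulr1.
have xother e : e != edge z -> path_chain x e = path_chain y e.
  move=> /eqP ez; rewrite Ex -[LHS]/(_ + a * edge_dirac z e) /edge_dirac.
  by rewrite (asboolF ez) mulr0 addr0.
split.
- move=> e; have [->//|ez] := eqVneq e (edge z).
  by rewrite xother// => /low; exact: low_edgeS.
- exists (edge z :: s0) => e; rewrite inE.
  by have [//|ez] := eqVneq e (edge z); rewrite xother// => /cov0.
- move=> s us cov.
  have zs : edge z \in s by apply: cov; rewrite xz.
  have covy e : path_chain y e != 0 -> e \in s.
    have [->|ez] := eqVneq e (edge z); first by rewrite yz eqxx.
    by rewrite -xother//; exact: cov.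
  have := sum s us covy.
  rewrite (bigD1_seq (edge z))//= yz expr0n add0r => sumy.
  rewrite (bigD1_seq (edge z))//= xz a1 -[in RHS]natr1 addrC -sumy.
  by congr (_ + _); apply: eq_bigr => e ez; rewrite xother.
Qed.

Definition tree_dist (x : Gam) : nat :=
  ex_minn (let: ex_intro n xn := reach_total x in
    ex_intro (fun n => `[< reach n x >]) n (asboolT xn)).

Lemma tree_distP x : reach (tree_dist x) x /\
  forall m, (m < tree_dist x)%N -> ~ reach m x.
Proof.
rewrite /tree_dist; case: ex_minnP => n /asboolP xn nmin; split=> // m mn.
by move=> /asboolP /nmin; rewrite leqNgt mn.
Qed.

Lemma path_chain_cover x :
  exists s : seq (set Gam), forall e, path_chain x e != 0 -> e \in s.
Proof. by have [xn xm] := tree_distP x; have [] := path_chain_norm xn xm. Qed.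

Lemma path_chain_sum x (s : seq (set Gam)) : uniq s ->
  (forall e, path_chain x e != 0 -> e \in s) ->
  \sum_(e <- s) path_chain x e ^+ 2 = (tree_dist x)%:R.
Proof.
move=> us se; have [xn xm] := tree_distP x.
by have [_ _] := path_chain_norm xn xm; apply.
Qed.

(** The distance between two vertices; [tree_kernelE] shows that it is the square
    of a Hilbert distance between path chains. *)
Definition tree_kernel (x y : Gam) : R := (tree_dist (y^-1 * x)%g)%:R.

Lemma tree_kernelE x y (s : seq (set Gam)) : uniq s ->
  (forall e, path_chain x e != 0 -> e \in s) ->
  (forall e, path_chain y e != 0 -> e \in s) ->
  tree_kernel x y = \sum_(e <- s) (path_chain x e - path_chain y e) ^+ 2.
Proof.
move=> us xs ys.
have xy e : path_chain x e - path_chain y e =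
    path_chain (y^-1 * x)%g [set z | e (y * z)%g].
  rewrite -{1}(mulVKg y x) path_chainM -[LHS]/(_ + path_chain y e - path_chain y e).
  by rewrite addrK.
under eq_bigr do rewrite xy.
rewrite -(big_map (fun e : set Gam => [set z | e (y * z)%g] : set Gam) xpredT
  (fun e => path_chain (y^-1 * x)%g e ^+ 2)) /tree_kernel path_chain_sum//.
  rewrite map_inj_uniq// => e e' /seteqP[le ge]; apply/seteqP; split=> z ez.
    by rewrite -(mulVKg y z); apply: le; rewrite /= mulVKg.
  by rewrite -(mulVKg y z); apply: ge; rewrite /= mulVKg.
move=> e; have -> : e = [set z | [set w | e (y^-1 * w)%g] (y * z)%g].
  by apply/funext => z /=; rewrite mulKg.
rewrite -xy => nz; apply/mapP; exists [set w | e (y^-1 * w)%g] => //.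
have [y0|] := eqVneq (path_chain y [set w | e (y^-1 * w)%g]) 0; last exact: ys.
by apply: xs; move: nz; rewrite y0 subr0.
Qed.

Lemma tree_kernel_cnd : cnd tree_kernel.
Proof.
split=> [x y|u u0].
  have [s xs] := path_chain_cover x; have [s' ys] := path_chain_cover y.
  have us := undup_uniq (s ++ s').
  have xs' e : path_chain x e != 0 -> e \in undup (s ++ s').
    by move=> /xs; rewrite mem_undup mem_cat => ->.
  have ys' e : path_chain y e != 0 -> e \in undup (s ++ s').
    by move=> /ys; rewrite mem_undup mem_cat orbC => ->.
  rewrite (tree_kernelE us xs' ys') (tree_kernelE us ys' xs').
  by apply: eq_bigr => e _; rewrite -sqrrN opprB.
have [s us cov] : exists2 s : seq (set Gam), uniq s &
    forall p, p \in u -> forall e, path_chain p.2 e != 0 -> e \in s.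
  elim: u {u0} => [|p u [s us su]]; first by exists [::].
  have [s' ps'] := path_chain_cover p.2.
  exists (undup (s' ++ s)); first exact: undup_uniq.
  move=> q; rewrite inE => /orP[/eqP -> e /ps'|/su qs e /qs];
  by rewrite mem_undup mem_cat => ->; rewrite ?orbT.
have -> : form tree_kernel u u = \sum_(e <- s)
    form (fun x y => (path_chain x e - path_chain y e) ^+ 2) u u.
  rewrite /form /ev exchange_big /=; apply: eq_big_seq => p pu.
  rewrite -mulr_sumr exchange_big /=; congr (_ * _); apply: eq_big_seq => q qu.
  by rewrite -mulr_sumr (tree_kernelE us (cov _ pu) (cov _ qu)).
apply: sumr_le0 => e _.
rewrite (eq_form (L := fun x y => path_chain x e ^+ 2 +
  (path_chain y e ^+ 2 + (-2) * (path_chain x e * path_chain y e)))) => [|x y];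
  last by ring.
rewrite !formD formZ form_left form_right u0 form_rank1 mulr0 mul0r !add0r.
by rewrite mulNr oppr_le0 mulr_ge0// -expr2 sqr_ge0.
Qed.

Lemma tree_dist0 g : tree_dist (base g) = 0%N.
Proof.
have [_ /(_ 0%N)] := tree_distP (base g).
case: (tree_dist _) => // n /(_ isT) nr.
by case: nr; exists g.
Qed.

End Tree.

Section TreeFinite.
Context (H : groupType) (G : preTopGroupType) (i1 i2 : H -> G).
Hypothesis i1_fin : finite_index (range i1).
Hypothesis i2_fin : finite_index (range i2).
Local Notation Gam := (hnn i1 i2).
Local Notation base := (@hnn_base H G i1 i2).
Local Notation t := (hnn_stable i1 i2 : Gam).

Lemma finite_index_reps (i : H -> G) : i 1%g = 1%g -> finite_index (range i) ->
  exists s : seq G, forall g, exists k h, k \in s /\ g = (k * i h)%g.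
Proof.
move=> i_1 /finite_seqP[cs Ecs].
have /choice[rep repP] : forall C : set G, exists k : G,
    C \in cs -> C = [set (k * a)%g | a in range i].
  move=> C; have [Cs|] := boolP (C \in cs); last by exists 1%g.
  have : [set` cs] C by [].
  by rewrite -Ecs => -[k _ <-]; exists k.
exists (map rep cs) => g.
have gs : [set (g * a)%g | a in range i] \in cs.
  have : [set` cs] [set (g * a)%g | a in range i] by rewrite -Ecs; exists g.
  by [].
have : [set (g * a)%g | a in range i] g.
  by exists 1%g; rewrite ?mulg1//; exists 1%g.
rewrite (repP _ gs) => -[_ [h _ <-] <-].
by exists (rep [set (g * a)%g | a in range i]), h; rewrite map_f.
Qed.

(** The tree is locally finite: up to finitely many cosets, an element of [G]
    in front of a stable letter lies in one associated subgroup and can be moved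
    to the other side. *)
Lemma reach_finite n : i1 1%g = 1%g -> i2 1%g = 1%g -> exists s : seq Gam,
  forall x, reach n x -> exists y g, y \in s /\ x = (y * base g)%g.
Proof.
move=> i1_1' i2_1'; elim: n => [|n [s IHs]].
  exists [:: 1%g] => x [g ->]; exists 1%g, g; rewrite inE eqxx mul1g//.
have [s1 s1P] := finite_index_reps i1_1' i1_fin.
have [s2 s2P] := finite_index_reps i2_1' i2_fin.
exists ([seq (y * base k * t)%g | y <- s, k <- s2] ++
        [seq (y * base k * t^-1)%g | y <- s, k <- s1]).
move=> x [y [g [/IHs[z [g' [zs ->]]] []]]] ->.
  have [k [h [ks ->]]] := s2P g'.
  exists (z * base k * t)%g, (i1 h * g)%g; split.
    by rewrite mem_cat; apply/orP; left; apply/allpairsPdep; exists z, k.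
  by rewrite !hnn_baseM !mulgA -(mulgA _ t (base (i1 h))) stable_i1 !mulgA.
have [k [h [ks ->]]] := s1P g'.
exists (z * base k * t^-1)%g, (i2 h * g)%g; split.
  by rewrite mem_cat; apply/orP; right; apply/allpairsPdep; exists z, k.
by rewrite !hnn_baseM !mulgA -(mulgA _ t^-1%g (base (i2 h))) stableV_i2 !mulgA.
Qed.

End TreeFinite.

(** * Gaussian kernels and stability of conditional negativity *)

Section ExplicitKernels.
Context {R : realType}.

Lemma psd_delta (T : eqType) : psd (fun x y : T => (x == y)%:R : R).
Proof.
split=> [x y|u]; first by rewrite eq_sym.
have -> : form (fun x y : T => (x == y)%:R : R) u u =
    \sum_(e <- undup [seq p.2 | p <- u])
      form (fun x y => (x == e)%:R * (y == e)%:R) u u.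
  rewrite /form /ev exchange_big /=; apply: eq_big_seq => p pu.
  rewrite -mulr_sumr exchange_big /=; congr (_ * _); apply: eq_bigr => q _.
  rewrite -mulr_sumr (bigD1_seq p.2) ?undup_uniq//= ?mem_undup ?map_f//.
  rewrite eqxx mul1r eq_sym big1 ?addr0// => e.
  by rewrite eq_sym => /negPf ->; rewrite mul0r.
by apply: sumr_ge0 => e _; rewrite form_rank1 -expr2 sqr_ge0.
Qed.

Lemma psd_average {X Y I : Type} (r : seq I) (h : I -> X -> Y) (K : Y -> Y -> R) :
  psd K -> psd (fun x y => \sum_(a <- r) \sum_(b <- r) K (h a x) (h b y)).
Proof.
move=> [Ks K0]; split=> [x y|u].
  rewrite exchange_big; apply: eq_bigr => a _; apply: eq_bigr => b _; exact: Ks.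
pose w := [seq (p.1, h a p.2) | p <- u, a <- r].
have evw f : ev f w = ev (fun x => \sum_(a <- r) f (h a x)) u.
  rewrite /ev big_allpairs_dep; apply: eq_bigr => p _.
  by rewrite mulr_sumr.
rewrite (_ : form _ u u = form K w w) ?K0// /form evw; apply: eq_ev => x.
rewrite -[LHS]/(ev (fun y => \sum_(a <- r) \sum_(b <- r) K (h a x) (h b y)) u).
under [RHS]eq_bigr do rewrite evw.
rewrite /ev exchange_big; apply: eq_bigr => p _.
by rewrite -mulr_sumr.
Qed.

(** The Gaussian is the exponential of the inner product, up to factors that
    depend on one variable each. *)
Lemma psd_gaussian (V : hilbert R) (s : R) : 0 <= s ->
  psd (fun x y : V => expR (- (s * `|x - y| ^+ 2))).
Proof.
move=> s0.
pose B (x y : V) := hdot V x y.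
have BC x y : B x y = B y x.
  by rewrite /B (hermitian_subproof x y) expr0 mul1r.
have BP a x y z : B (a *: x + y) z = a * B x z + B y z by exact: linearPl.
have B0 z : B 0 z = 0 by exact: linear0l.
have Bev u z : ev (B^~ z) u = B (\sum_(p <- u) p.1 *: p.2) z.
  elim: u => [|p u IHu]; first by rewrite big_nil B0 ev_nil.
  by rewrite big_cons ev_cons BP IHu.
have dotp : psd B.
  split=> // u; rewrite /form.
  rewrite (eq_ev (g := B^~ (\sum_(p <- u) p.1 *: p.2))) => [|x].
    by rewrite Bev /B hdotE sqr_ge0.
  by rewrite BC -Bev; apply: eq_ev => y; exact: BC.
have E x y : expR (- (s * `|x - y| ^+ 2)) =
    (expR (- (s * `|x| ^+ 2)) * expR (- (s * `|y| ^+ 2))) * expR (2 * s * B x y).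
  rewrite -!expRD; congr expR; rewrite -!hdotE.
  have Bm a b c : B (a - b) c = B a c - B b c.
    by rewrite addrC -scaleN1r BP mulN1r addrC.
  rewrite -/(B x x) -/(B y y) -/(B (x - y) (x - y)) Bm BC Bm (BC _ (x - y)) Bm (BC y x).
  by ring.
apply: eq_psd; first by move=> x y; exact/esym/E.
apply: psdM; first exact: psd_rank1.
by apply/psd_exp/psdZ => //; rewrite mulr_ge0.
Qed.

Lemma cnd_of_psd {X : Type} (K : X -> X -> R) : psd K -> cnd (fun x y => 1 - K x y).
Proof.
move=> [Ks K0]; split=> [x y|u u0]; first by rewrite Ks.
rewrite (eq_form (L := fun x y => 1 + (-1) * K x y)) => [|x y]; last by ring.
have E1 : form (fun _ _ => 1) u u = 0 by rewrite [LHS]form_left u0 mul0r.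
by rewrite formD formZ E1 add0r mulN1r oppr_le0.
Qed.

Lemma cndD {X : Type} (K L : X -> X -> R) :
  cnd K -> cnd L -> cnd (fun x y => K x y + L x y).
Proof.
move=> [Ks K0] [Ls L0]; split=> [x y|u u0]; first by rewrite Ks Ls.
by rewrite formD -oppr_ge0 opprD addr_ge0// oppr_ge0 ?K0 ?L0.
Qed.

Lemma cnd_sum {X : Type} (K : nat -> X -> X -> R) n : (forall k, cnd (K k)) ->
  cnd (fun x y => \sum_(0 <= k < n) K k x y).
Proof.
move=> Kc; elim: n => [|n [Ss S0]].
  split=> [x y|u u0]; first by rewrite !big_geq.
  rewrite (eq_form (L := fun x y => 0)) => [|x y]; last by rewrite big_geq.
  by rewrite [leLHS]form_left u0 mulr0.
split=> [x y|u u0]; first by rewrite !big_nat_recr//= Ss (Kc n).1.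
rewrite (eq_form (L := fun x y => \sum_(0 <= k < n) K k x y + K n x y)) => [|x y].
  exact: (cndD (conj Ss S0) (Kc n)).2.
by rewrite big_nat_recr.
Qed.

Lemma cnd_lim {X : Type} (K_ : nat -> X -> X -> R) K : (forall n, cnd (K_ n)) ->
  (forall x y, K_ n x y @[n --> \oo] --> K x y) -> cnd K.
Proof.
move=> Kp KK; split=> [x y|u u0].
  rewrite -(cvg_lim _ (KK x y))// -(cvg_lim _ (KK y x))//.
  by under eq_fun do rewrite (Kp _).1.
have C := cvg_form (u := u) (v := u) KK.
rewrite -(cvg_lim _ C)//; apply: limr_le; first by apply: cvgP C.
by apply: nearW => n; exact: (Kp n).2.
Qed.

Lemma psd_le_diag {X : Type} (K : X -> X -> R) x y : psd K -> K x x = 1 -> K y y = 1 ->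
  K x y <= 1.
Proof.
move=> [Ks K0] Kx Ky; have := K0 [:: (1, x); (-1, y)].
rewrite /form !ev_cons !ev_nil /= Kx Ky (Ks y x); lra.
Qed.

End ExplicitKernels.

(** * Counting and summation bounds *)

Lemma sum_eqn_iota c n : (\sum_(b <- iota 0 n) (c == b) = (c < n))%N.
Proof.
rewrite (eq_bigr (fun b => if c == b then 1 else 0)%N) => [|b _]; last by case: eqP.
rewrite -big_mkcond sum1_count (eq_count (a2 := pred1 c)) => [|b]; last exact: eq_sym.
by rewrite count_uniq_mem ?iota_uniq// mem_iota.
Qed.

Lemma sum_shift_iota d n M : (M <= n ->
  minn M (n - d) <= \sum_(a <- iota 0 M) \sum_(b <- iota 0 n) (d + a == b))%N.
Proof.
elim: M => [|M IHM] Mn; first by rewrite min0n.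
have := IHM (ltnW Mn).
by rewrite -addn1 iotaD big_cat /= big_seq1 add0n sum_eqn_iota; lia.
Qed.

Lemma box_overlap (m : int) n : (n - `|m| <=
  \sum_(a <- iota 0 n) \sum_(b <- iota 0 n) (m + a%:Z == b%:Z)%R)%N.
Proof.
case: (intP m) => [|d|d].
- apply: leq_trans (sum_shift_iota 0 (leqnn n)); by lia.
- apply: leq_trans (sum_shift_iota d.+1 (leqnn n)); by lia.
- rewrite exchange_big /=.
  apply: (@leq_trans (\sum_(a <- iota 0 n) \sum_(b <- iota 0 n) (d.+1 + a == b))%N).
    by apply: leq_trans (sum_shift_iota d.+1 (leqnn n)); lia.
  apply: leq_sum => a _; apply: leq_sum => b _.
  case: eqVneq => // e; rewrite -e lt0b; apply/eqP; by lia.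
Qed.

Lemma geometric_tail (R : realType) (f : nat -> R) M : (forall k, 0 <= f k) ->
  (forall k, (M <= k)%N -> f k <= 2 * 2^-1 ^+ k) ->
  forall n, \sum_(0 <= k < n) f k <= \sum_(0 <= k < M) f k + 4 * 2^-1 ^+ M.
Proof.
move=> f0 fM n.
have tail p : \sum_(0 <= k < M + p) f k <=
    \sum_(0 <= k < M) f k + 4 * 2^-1 ^+ M - 4 * 2^-1 ^+ (M + p).
  elim: p => [|p IHp]; first by rewrite addn0 addrK.
  rewrite addnS big_nat_recr//= exprS.
  have := fM (M + p)%N (leq_addr _ _); move: IHp.
  move: (\sum_(_ <= _ < _) _) => S; move: (2^-1 ^+ (M + p)) => e.
  lra.
have mono p : \sum_(0 <= k < n) f k <= \sum_(0 <= k < n + p) f k.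
  rewrite [leRHS](@big_cat_nat _ _ _ n) ?leq_addr//= lerDl.
  by apply: sumr_ge0.
apply: (le_trans (mono M)); rewrite addnC; apply: (le_trans (tail n)).
by rewrite gerBl mulr_ge0// exprn_ge0// invr_ge0.
Qed.

(** * The kernel of the ambient group extended by its automorphism *)

Section Ambient.
Context {R : realType} {N G : topGroupType} {H : groupType}.
Variables (j : G -> N) (i1 i2 : H -> G) (phi phiV : N -> N).
Variables (V : hilbert R) (alpha : N -> V -> V).
Hypothesis jM : {morph j : x y / (x * y)%g}.
Hypothesis j_cont : continuous j.
Hypothesis phiM : {morph phi : x y / (x * y)%g}.
Hypothesis phiK : cancel phi phiV.
Hypothesis phiVK : cancel phiV phi.
Hypothesis phi_cont : continuous phi.
Hypothesis phiV_cont : continuous phiV.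
Hypothesis phi_conj : forall h, phi (j (i1 h)) = j (i2 h).
Hypothesis alpha_aff : affine_isometric_action alpha.
Hypothesis alpha_proper : metrically_proper alpha.
Local Notation Gam := (hnn i1 i2).
Local Notation base := (@hnn_base H G i1 i2).

Lemma phiVM : {morph phiV : x y / (x * y)%g}.
Proof. by move=> x y; rewrite -{1}(phiVK x) -{1}(phiVK y) -phiM phiK. Qed.

(** The power [phi^(-m)]. *)
Definition twist (m : int) : N -> N :=
  match m with
  | Posz n => iter n phiV
  | Negz n => iter n.+1 phi
  end.

Lemma twistM m : {morph twist m : x y / (x * y)%g}.
Proof.
case: m => n x y; rewrite /twist.
  by elim: n => //= n ->; rewrite phiVM.
by elim: n.+1 => //= k ->; rewrite phiM.
Qed.

Lemma twist_phi m n : twist m (phi n) = twist (m - 1) n.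
Proof.
case: m => [[//|k]|k].
  by rewrite (_ : Posz k.+1 - 1 = Posz k) /=; [rewrite -iterS iterSr phiK|lia].
by rewrite (_ : Negz k - 1 = Negz k.+1) ?[in LHS]/twist -?iterSr // !NegzE; lia.
Qed.

Lemma twistS m n : twist (m + 1) n = phiV (twist m n).
Proof.
case: m => [k|[|k]].
- by rewrite (_ : Posz k + 1 = Posz k.+1) // -PoszD addn1.
- by rewrite /= phiK.
- by rewrite (_ : Negz k.+1 + 1 = Negz k) ?[in RHS]/twist /= ?phiK // !NegzE; lia.
Qed.

Lemma twistD m (a : nat) n : twist (m + a%:Z) n = iter a phiV (twist m n).
Proof.
elim: a => [|a IHa] /=; first by rewrite addr0.
by rewrite -IHa -twistS -addrA -PoszD addn1.
Qed.

Definition ambient_base (g : G) (x : N * int) : N * int :=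
  ((twist x.2 (j g) * x.1)%g, x.2).
Definition ambient_up (x : N * int) : N * int := (x.1, x.2 + 1).
Definition ambient_down (x : N * int) : N * int := (x.1, x.2 - 1).

(** The action of the extension on the semidirect product of [N] and the powers
    of [phi]; the pair [(q, m)] stands for [phi^m q]. In these coordinates the
    stable letter is a shift and all the twisting is in the action of [G]. *)
Definition ambient_act (x : Gam) : N * int -> N * int :=
  @hnn_act H G i1 i2 _ ambient_base ambient_up ambient_down x.

Lemma jM1 : j 1%g = 1%g.
Proof. by apply: (mulgI (j 1%g)); rewrite -jM !mulg1. Qed.

Lemma twist1 m : twist m 1%g = 1%g.
Proof. by apply: (mulgI (twist m 1%g)); rewrite -twistM !mulg1. Qed.

Lemma ambient_base1 x : ambient_base 1%g x = x.
Proof. by case: x => q m; rewrite /ambient_base jM1 twist1 mul1g. Qed.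

Lemma ambient_baseM g g' x :
  ambient_base (g * g')%g x = ambient_base g (ambient_base g' x).
Proof. by rewrite /ambient_base /= jM twistM mulgA. Qed.

Lemma ambient_upK : cancel ambient_up ambient_down.
Proof. by case=> q m; rewrite /ambient_up /ambient_down /= addrK. Qed.

Lemma ambient_downK : cancel ambient_down ambient_up.
Proof. by case=> q m; rewrite /ambient_up /ambient_down /= subrK. Qed.

Lemma ambient_conj h x :
  ambient_up (ambient_base (i1 h) (ambient_down x)) = ambient_base (i2 h) x.
Proof.
by rewrite /ambient_up /ambient_base /= subrK -twist_phi phi_conj.
Qed.

Lemma ambient_act1 x : ambient_act 1%g x = x.
Proof.
apply: hnn_act1; [exact: ambient_base1|exact: ambient_baseM|exact: ambient_upK|
  exact: ambient_downK|exact: ambient_conj].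
Qed.

Lemma ambient_actM y z x : ambient_act (y * z)%g x = ambient_act y (ambient_act z x).
Proof.
apply: hnn_actM; [exact: ambient_base1|exact: ambient_baseM|exact: ambient_upK|
  exact: ambient_downK|exact: ambient_conj].
Qed.

Lemma ambient_act_base g x : ambient_act (base g) x = ambient_base g x.
Proof.
apply: hnn_act_base; [exact: ambient_base1|exact: ambient_baseM|exact: ambient_upK|
  exact: ambient_downK|exact: ambient_conj].
Qed.

Lemma ambient_act_stable x : ambient_act (hnn_stable i1 i2) x = ambient_up x.
Proof.
apply: hnn_act_stable; [exact: ambient_base1|exact: ambient_baseM|exact: ambient_upK|
  exact: ambient_downK|exact: ambient_conj].
Qed.

Lemma ambient_act_stableV x :
  ambient_act (hnn_stable i1 i2 : Gam)^-1%g x = ambient_down x.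
Proof.
apply: hnn_act_stableV; [exact: ambient_base1|exact: ambient_baseM|exact: ambient_upK|
  exact: ambient_downK|exact: ambient_conj].
Qed.

Lemma ambient_act_mulr (y : Gam) q p m :
  ambient_act y ((q * p)%g, m) =
  (((ambient_act y (q, m)).1 * p)%g, (ambient_act y (q, m)).2).
Proof.
elim/hnn_ind: y => [|g x IHx|x IHx|x IHx].
- by rewrite !ambient_act1.
- by rewrite !ambient_actM IHx !ambient_act_base /ambient_base /= mulgA.
- by rewrite !ambient_actM IHx !ambient_act_stable.
- by rewrite !ambient_actM IHx !ambient_act_stableV.
Qed.

Definition ambient_pt (x : Gam) : N * int := ambient_act x (1%g, 0).

Lemma ambient_ptM_base (y : Gam) g :
  (ambient_pt (y * base g)%g).1 = ((ambient_pt y).1 * j g)%g.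
Proof.
rewrite /ambient_pt ambient_actM ambient_act_base /ambient_base /= mulg1.
by rewrite -{1}(mul1g (j g)) ambient_act_mulr.
Qed.

Definition cocycle (p : N) : V := alpha p 0.

Lemma cocycle1 : cocycle 1%g = 0.
Proof. by case: alpha_aff => -[a1 _] _ _ _; exact: a1. Qed.

Lemma cocycle_dist h p q :
  `|cocycle (h * p)%g - cocycle (h * q)%g| = `|cocycle p - cocycle q|.
Proof.
case: alpha_aff => -[_ aM] _ iso _.
by rewrite /cocycle !aM iso.
Qed.

Lemma cocycle_continuous : continuous cocycle.
Proof.
case: alpha_aff => _ _ _ ac p.
apply: (@continuous2_cvg _ _ _ _ _ _ id (fun=> 0) alpha).
- exact: (ac (p, 0)).
- exact: cvg_id.
- exact: cvg_cst.
Qed.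

Lemma cocycle_ball_compact (r : R) : 0 < r -> compact [set p | `|cocycle p| <= r].
Proof.
move=> r0; rewrite -precompact_closed; first exact: alpha_proper.
rewrite -[X in closed X]/((fun p => `|cocycle p|) @^-1` [set x | x <= r]).
apply: preimage_closed => [p _|]; last exact: closed_le.
by apply: cvg_norm; exact: cocycle_continuous.
Qed.

Definition cell_kernel (s : R) (x y : int * N) : R :=
  (x.1 == y.1)%:R * expR (- (s * `|cocycle x.2 - cocycle y.2| ^+ 2)).

Definition sample (a : nat) (x : N * int) : int * N := (x.2 + a%:Z, iter a phiV x.1).

(** A matrix coefficient of the representation of the semidirect product induced
    from the Gaussian of the action of [N], at a vector supported on a box of [n]
    consecutive integers. The automorphism shifts the box, and a long box is nearly
    equal to its translates. *)
Definition box_kernel (n : nat) (s : R) (x y : N * int) : R :=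
  n%:R^-1 * \sum_(a <- iota 0 n) \sum_(b <- iota 0 n)
    cell_kernel s (sample a x) (sample b y).

Lemma box_kernel_psd n s : 0 <= s -> psd (box_kernel n s).
Proof.
move=> s0; apply: psdZ; first by rewrite invr_ge0.
apply: psd_average; apply: psdM.
  exact: (psd_comp (fun x : int * N => x.1) (psd_delta _)).
exact: (psd_comp (fun x : int * N => cocycle x.2) (psd_gaussian _ s0)).
Qed.

Lemma box_kernel_inv n s (z : Gam) x y :
  box_kernel n s (ambient_act z x) (ambient_act z y) = box_kernel n s x y.
Proof.
have E (f : N * int -> N * int) : (forall a b x y,
    cell_kernel s (sample a (f x)) (sample b (f y)) =
    cell_kernel s (sample a x) (sample b y)) ->
    forall x y, box_kernel n s (f x) (f y) = box_kernel n s x y.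
  move=> fE u v; congr (_ * _); apply: eq_bigr => a _.
  by apply: eq_bigr => b _; exact: fE.
elim/hnn_ind: z x y => [|g z IHz|z IHz|z IHz] x y.
- by rewrite !ambient_act1.
- rewrite !ambient_actM !ambient_act_base E ?IHz// => a b [q m] [q' m'].
  rewrite /cell_kernel /sample /ambient_base /=.
  have [e|] := eqVneq (m + a%:Z) (m' + b%:Z); last by rewrite !mul0r.
  rewrite (_ : iter a phiV _ = (twist (m + a%:Z) (j g) * iter a phiV q)%g); last first.
    by rewrite -[iter a phiV (_ * _)%g]/(twist a%:Z _) twistM twistD.
  rewrite (_ : iter b phiV _ = (twist (m' + b%:Z) (j g) * iter b phiV q')%g); last first.
    by rewrite -[iter b phiV (_ * _)%g]/(twist b%:Z _) twistM twistD.
  by rewrite e cocycle_dist.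
- rewrite !ambient_actM !ambient_act_stable E ?IHz// => a b u v.
  rewrite /cell_kernel /sample /ambient_up /=.
  by rewrite -!(addrAC _ _ 1) (inj_eq (addIr 1)).
- rewrite !ambient_actM !ambient_act_stableV E ?IHz// => a b u v.
  rewrite /cell_kernel /sample /ambient_down /=.
  by rewrite -!(addrAC _ _ (-1)) (inj_eq (addIr (-1))).
Qed.

Lemma box_kernel_diag n s x : (0 < n)%N -> box_kernel n s x x = 1.
Proof.
move=> n0; rewrite /box_kernel.
rewrite (eq_big_seq (fun=> 1)) => [|a ain].
  by rewrite big_const_seq count_predT size_iota iter_addr_0 mulVf// pnatr_eq0 -lt0n.
rewrite (bigD1_seq a)//= ?iota_uniq// /cell_kernel /sample /= eqxx subrr.
rewrite normr0 expr0n mulr0 oppr0 expR0 mul1r big1 ?addr0// => b ba.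
by rewrite (inj_eq (addrI _)) eqz_nat eq_sym (negPf ba) mul0r.
Qed.

Lemma box_kernel_le1 n s x y : 0 <= s -> (0 < n)%N -> box_kernel n s x y <= 1.
Proof.
by move=> s0 n0; apply: psd_le_diag; rewrite ?box_kernel_diag//; exact: box_kernel_psd.
Qed.

Lemma cell_kernel_ge0 s x y : 0 <= cell_kernel s x y.
Proof. by rewrite mulr_ge0 ?expR_ge0. Qed.

Lemma box_kernel_ge0 n s x y : 0 <= box_kernel n s x y.
Proof.
rewrite mulr_ge0 ?invr_ge0// sumr_ge0// => a _.
by rewrite sumr_ge0// => b _; exact: cell_kernel_ge0.
Qed.

Lemma iter_phiV1 a : iter a phiV 1%g = 1%g.
Proof. exact: (twist1 a%:Z). Qed.

Lemma cell_kernel_base s a b q m :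
  cell_kernel s (sample a (q, m)) (sample b (1%g, 0)) =
  (m + a%:Z == b%:Z)%:R * expR (- (s * `|cocycle (iter a phiV q)| ^+ 2)).
Proof. by rewrite /cell_kernel /sample /= add0r iter_phiV1 cocycle1 subr0. Qed.

(** The first error counts the translates that leave the box, the second bounds
    the defect of the Gaussians. *)
Lemma box_kernel_lower n s q m d e : (0 < n)%N -> 0 <= s -> 0 <= e ->
  (`|m| <= d)%N ->
  (forall a, (a < n)%N -> s * `|cocycle (iter a phiV q)| ^+ 2 <= e) ->
  1 - box_kernel n s (q, m) (1%g, 0) <= d%:R / n%:R + e.
Proof.
move=> n0 s0 e0 md he.
have nR : 0 < n%:R :> R by rewrite ltr0n.
have dn0 : 0 <= d%:R / n%:R :> R by rewrite divr_ge0.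
have [e1|e1] := leP 1 e.
  by have := box_kernel_ge0 n s (q, m) (1%g, 0); lra.
suff : (1 - d%:R / n%:R) * (1 - e) <= box_kernel n s (q, m) (1%g, 0).
  have : 0 <= d%:R / n%:R * e by rewrite mulr_ge0.
  lra.
rewrite /box_kernel mulrC.
apply: (@le_trans _ _ (n%:R^-1 * ((n - `|m|)%:R * (1 - e)))).
  have -> : 1 - d%:R / n%:R = n%:R^-1 * (n%:R - d%:R) :> R by field; rewrite gt_eqF.
  rewrite mulrC -mulrA ler_pM2l ?invr_gt0// ler_wpM2r//; first by lra.
  rewrite lerBlDr -natrD ler_nat; lia.
rewrite ler_pM2l ?invr_gt0//.
apply: (@le_trans _ _ ((\sum_(a <- iota 0 n) \sum_(b <- iota 0 n)
    (m + a%:Z == b%:Z)%R)%N%:R * (1 - e))).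
  by rewrite ler_wpM2r ?ler_nat ?box_overlap//; lra.
rewrite natr_sum mulr_suml big_seq [leRHS]big_seq; apply: ler_sum => a.
rewrite mem_iota /= add0n => an.
rewrite natr_sum mulr_suml; apply: ler_sum => b _.
rewrite cell_kernel_base; case: eqP => _; last by rewrite !mul0r.
rewrite !mul1r; apply: le_trans (expR_ge1Dx _).
by rewrite lerD2l lerN2; exact: he.
Qed.

(** An average of Gaussians exceeds [1/2] only if one of them does. *)
Lemma box_kernel_upper n s q m : (0 < n)%N ->
  1 / 2 < box_kernel n s (q, m) (1%g, 0) ->
  exists2 a, (a < n)%N & s * `|cocycle (iter a phiV q)| ^+ 2 <= 1.
Proof.
move=> n0 half; apply: contrapT => far.
have {}far a : (a < n)%N -> 1 < s * `|cocycle (iter a phiV q)| ^+ 2.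
  by move=> an; rewrite ltNge; apply/negP => le1; apply: far; exists a.
have nR : 0 < n%:R :> R by rewrite ltr0n.
move: half; apply/negP; rewrite -leNgt /box_kernel.
rewrite mulrC ler_pdivrMr//.
have -> : 1 / 2 * n%:R = \sum_(a <- iota 0 n) (1 / 2) :> R.
  by rewrite big_const_seq count_predT size_iota iter_addr_0 -[RHS]mulr_natr.
rewrite big_seq [leRHS]big_seq; apply: ler_sum => a; rewrite mem_iota /= add0n => an.
under eq_bigr do rewrite cell_kernel_base.
have e0 : expR (- (s * `|cocycle (iter a phiV q)| ^+ 2)) <= 1 / 2.
  have x1 := far _ an; rewrite expRN mul1r.
  have ge2 : 2 <= expR (s * `|cocycle (iter a phiV q)| ^+ 2).
    by apply: le_trans (expR_ge1Dx _); lra.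
  by rewrite lef_pV2 ?posrE ?expR_gt0.
rewrite -mulr_suml -[leRHS]mul1r ler_pM ?expR_ge0 ?sumr_ge0//.
rewrite -natr_sum (_ : 1 = 1%:R)// ler_nat.
case: (m + a%:Z) => c; last by rewrite big1.
by rewrite sum_eqn_iota; case: (_ < _)%N.
Qed.

Lemma iter_phiV_continuous a : continuous (iter a phiV).
Proof.
elim: a => [|a IHa] p; first exact: cvg_id.
by apply: (cvg_comp (iter a phiV) phiV); [exact: IHa|exact: phiV_cont].
Qed.

Lemma iter_phi_continuous a : continuous (iter a phi).
Proof.
elim: a => [|a IHa] p; first exact: cvg_id.
by apply: (cvg_comp (iter a phi) phi); [exact: IHa|exact: phi_cont].
Qed.

Lemma cocycle_iter_bounded (c : R) n : 0 < c -> exists2 B, 0 < B &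
  forall a q, (a < n)%N -> `|cocycle q| <= c -> `|cocycle (iter a phiV q)| <= B.
Proof.
move=> c0; elim: n => [|n [B B0 HB]]; first by exists 1.
have cf : continuous (fun q => cocycle (iter n phiV q)).
  move=> q; apply: (cvg_comp (iter n phiV) cocycle).
    exact: iter_phiV_continuous.
  exact: cocycle_continuous.
have : compact ((fun q => cocycle (iter n phiV q)) @` [set q | `|cocycle q| <= c]).
  apply: continuous_compact; last exact: cocycle_ball_compact.
  by apply: continuous_subspaceT => q; exact: cf.
move=> /compact_bounded[M [_ /(_ (`|M| + 1))]].
rewrite (le_lt_trans (ler_norm M)) ?ltrDl// => /(_ isT) HM.
exists (B + (`|M| + 1)); first by rewrite addr_gt0// ltr_wpDl.
move=> a q; rewrite ltnS leq_eqVlt => /orP[/eqP -> qc|an qc].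
  rewrite (@le_trans _ _ (`|M| + 1))//; last by rewrite lerDr ltW.
  by apply: HM; exists q.
by apply: (le_trans (HB _ _ an qc)); rewrite lerDl addr_ge0.
Qed.

(** Kernels that are uniformly close to [1] on larger and larger bounded sets: a
    long box handles the shift by [m], and a slowly decaying Gaussian handles the
    values of the cocycle, which are bounded over the box because closed balls of
    [N] are compact. *)
Lemma box_params k : exists ns : nat * R, [/\ (0 < ns.1)%N, 0 < ns.2 &
  forall q m, `|cocycle q| <= k.+1%:R -> (`|m| <= k)%N ->
    1 - box_kernel ns.1 ns.2 (q, m) (1%g, 0) <= 2 * 2^-1 ^+ k].
Proof.
pose n := (k.+1 * 2 ^ k)%N.
have n0 : (0 < n)%N by rewrite muln_gt0 expn_gt0.
have [B B0 HB] := @cocycle_iter_bounded k.+1%:R n (ltr0Sn _ _).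
have e0 : 0 < 2^-1 ^+ k :> R by rewrite exprn_gt0// invr_gt0.
exists (n, 2^-1 ^+ k / B ^+ 2); split => //=; first by rewrite divr_gt0// exprn_gt0.
move=> q m qk mk.
apply: (le_trans (@box_kernel_lower _ _ _ _ k (2^-1 ^+ k) _ _ _ _ _)) => //.
- by rewrite divr_ge0// ?sqr_ge0// ltW.
- move=> a an; rewrite mulrAC ler_pdivrMr ?exprn_gt0// ler_pM2l//.
  by rewrite ler_pXn2r ?nnegrE ?normr_ge0 ?(ltW B0)//; exact: HB.
rewrite mulrDl mul1r lerD2r /n natrM natrX invfM exprVn mulrA.
rewrite ler_piMl ?invr_ge0 ?exprn_ge0//.
by rewrite ler_pdivrMr ?ltr0Sn// mul1r ler_nat.
Qed.

Section Series.
Variable par : nat -> nat * R.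
Hypothesis par_n : forall k, (0 < (par k).1)%N.
Hypothesis par_s : forall k, 0 < (par k).2.
Hypothesis par_le : forall k q m, `|cocycle q| <= k.+1%:R -> (`|m| <= k)%N ->
  1 - box_kernel (par k).1 (par k).2 (q, m) (1%g, 0) <= 2 * 2^-1 ^+ k.

(** Each kernel vanishes at infinity of [N], so its defect tends to [1] there;
    summing infinitely many defects gives an unbounded kernel. *)
Definition defect k (x y : Gam) : R :=
  1 - box_kernel (par k).1 (par k).2 (ambient_pt x) (ambient_pt y).

Definition partial_kernel n (x y : Gam) : R := \sum_(0 <= k < n) defect k x y.

Definition ambient_kernel (x y : Gam) : R := limn (fun n => partial_kernel n x y).

Lemma defect_ge0 k x y : 0 <= defect k x y.
Proof. by rewrite subr_ge0 box_kernel_le1// ltW. Qed.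

Lemma defect_inv k z x y : defect k (z * x)%g (z * y)%g = defect k x y.
Proof. by rewrite /defect /ambient_pt !ambient_actM box_kernel_inv. Qed.

Lemma partial_kernel_inv n z x y :
  partial_kernel n (z * x)%g (z * y)%g = partial_kernel n x y.
Proof. by apply: eq_bigr => k _; exact: defect_inv. Qed.

Lemma ambient_kernel_inv z x y :
  ambient_kernel (z * x)%g (z * y)%g = ambient_kernel x y.
Proof.
by rewrite /ambient_kernel; under eq_fun do rewrite partial_kernel_inv.
Qed.

Lemma partial_kernel_diag n x : partial_kernel n x x = 0.
Proof. by apply: big1 => k _; rewrite /defect box_kernel_diag// subrr. Qed.

Lemma ambient_kernel_diag x : ambient_kernel x x = 0.
Proof.
rewrite /ambient_kernel; under eq_fun do rewrite partial_kernel_diag.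
exact: lim_cst.
Qed.

Lemma ambient_pt1 : ambient_pt 1%g = (1%g, 0).
Proof. exact: ambient_act1. Qed.

Lemma partial_kernel_bound M x :
  `|cocycle (ambient_pt x).1| <= M.+1%:R -> (`|(ambient_pt x).2| <= M)%N ->
  forall n, partial_kernel n x 1%g <= partial_kernel M x 1%g + 4 * 2^-1 ^+ M.
Proof.
move=> qM mM n; apply: geometric_tail => [k|k Mk]; first exact: defect_ge0.
rewrite /defect ambient_pt1; case: (ambient_pt x) qM mM => q m /= qM mM.
apply: par_le; last exact: leq_trans Mk.
by apply: (le_trans qM); rewrite ler_nat ltnS.
Qed.

Lemma partial_kernel_mono x y : nondecreasing_seq (fun n => partial_kernel n x y).
Proof.
apply/nondecreasing_seqP => n; rewrite /partial_kernel big_nat_recr//= lerDl.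
exact: defect_ge0.
Qed.

Lemma partial_kernel_cvg x y :
  partial_kernel n x y @[n --> \oo] --> ambient_kernel x y.
Proof.
suff cvg1 z : partial_kernel n z 1%g @[n --> \oo] --> ambient_kernel z 1%g.
  have := cvg1 (y^-1 * x)%g.
  rewrite -(ambient_kernel_inv y) mulVKg mulg1.
  by under eq_fun do rewrite -(partial_kernel_inv _ y) mulVKg mulg1.
move: z => {}x; apply: nondecreasing_is_cvgn; first exact: partial_kernel_mono.
pose M := maxn `|(ambient_pt x).2| (Num.truncn `|cocycle (ambient_pt x).1|).
exists (partial_kernel M x 1%g + 4 * 2^-1 ^+ M) => _ [n _ <-].
apply: partial_kernel_bound; last exact: leq_maxl.
apply: ltW; apply: (lt_le_trans (truncnS_gt _)).
by rewrite ler_nat ltnS leq_maxr.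
Qed.

Lemma partial_kernel_le n x y : partial_kernel n x y <= ambient_kernel x y.
Proof.
apply: nondecreasing_cvgn_le; first exact: partial_kernel_mono.
by apply/cvg_ex; exists (ambient_kernel x y); exact: partial_kernel_cvg.
Qed.

Lemma ambient_kernel_ge0 x y : 0 <= ambient_kernel x y.
Proof.
by apply: le_trans (partial_kernel_le 0 x y); rewrite /partial_kernel big_geq.
Qed.

Lemma ambient_kernel_cnd : cnd ambient_kernel.
Proof.
apply: (cnd_lim (K_ := partial_kernel)) => [n|]; last exact: partial_kernel_cvg.
apply: cnd_sum => k; apply: cnd_of_psd.
by apply: (psd_comp ambient_pt); apply: box_kernel_psd; exact: ltW.
Qed.

Lemma ambient_pt_base g : ambient_pt (base g) = (j g, 0).
Proof. by rewrite /ambient_pt ambient_act_base /ambient_base /= mulg1. Qed.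

Lemma cocycle_j_continuous a : continuous (fun g => cocycle (iter a phiV (j g))).
Proof.
move=> g; apply: (cvg_comp (fun g => iter a phiV (j g)) cocycle).
  apply: (cvg_comp j (iter a phiV)); first exact: j_cont.
  exact: iter_phiV_continuous.
exact: cocycle_continuous.
Qed.

Lemma partial_kernel_base_continuous n :
  continuous (fun g => partial_kernel n (base g) 1%g).
Proof.
move=> g; apply: cvg_big => [|k _]; first exact: add_continuous.
rewrite /defect ambient_pt1; apply: cvgB; first exact: cvg_cst.
rewrite /box_kernel; apply: cvgMl_tmp.
apply: cvg_big => [|a _]; first exact: add_continuous.
apply: cvg_big => [|b _]; first exact: add_continuous.
rewrite ambient_pt_base cell_kernel_base.
rewrite (_ : (fun h => _) = fun h => (0 + a%:Z == b%:Z)%:R *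
    expR (- ((par k).2 * `|cocycle (iter a phiV (j h))| ^+ 2))); last first.
  by apply/funext => h; rewrite ambient_pt_base cell_kernel_base.
apply: cvgMl_tmp.
apply: (cvg_comp _ expR); last exact: continuous_expR.
apply: cvgN; apply: cvgMl_tmp.
rewrite expr2; under eq_fun do rewrite expr2.
by apply: cvgM; apply: cvg_norm; exact: cocycle_j_continuous.
Qed.

Lemma ambient_kernel_near1 e : 0 < e ->
  \forall g \near (1%g : G), ambient_kernel (base g) 1%g < e.
Proof.
move=> e0.
have [M Me] : exists M, 4 * 2^-1 ^+ M < e / 2.
  have e80 : 0 < e / 8 by exact: divr_gt0.
  have : 2^-1 ^+ M @[M --> \oo] --> (0 : R).
    by apply: cvg_expr; rewrite ger0_norm ?invr_ge0// invf_lt1// ltr1n.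
  move=> /cvgrPdist_lt/(_ _ e80)[M _ /(_ M (leqnn M))] /=.
  rewrite sub0r normrN ger0_norm ?exprn_ge0 ?invr_ge0// => Me; exists M.
  by lra.
have e20 : 0 < e / 2 by exact: divr_gt0.
have /cvgrPdist_lt/(_ _ e20) near1 := @partial_kernel_base_continuous M 1%g.
have /cvgrPdist_lt/(_ 1 ltr01) near2 := @cocycle_j_continuous 0 1%g.
near=> g.
have small : partial_kernel M (base g) 1%g < e / 2.
  have : `|partial_kernel M (base 1%g) 1%g - partial_kernel M (base g) 1%g| < e / 2.
    by near: g.
  by rewrite hnn_base1 partial_kernel_diag sub0r normrN; exact/le_lt_trans/ler_norm.
have gle : `|cocycle (j g)| <= 1.
  have : `|cocycle (iter 0 phiV (j 1%g)) - cocycle (iter 0 phiV (j g))| < 1.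
    by near: g.
  by rewrite /= jM1 cocycle1 sub0r normrN => /ltW.
apply: (@le_lt_trans _ _ (partial_kernel M (base g) 1%g + 4 * 2^-1 ^+ M)).
  apply: limr_le.
    by apply/cvg_ex; exists (ambient_kernel (base g) 1%g); exact: partial_kernel_cvg.
  apply: nearW => n; apply: partial_kernel_bound; rewrite ambient_pt_base//.
  by apply: (le_trans gle); rewrite ler1n.
by lra.
Unshelve. all: by end_near. Qed.

Lemma iter_phiK a : cancel (iter a phiV) (iter a phi).
Proof. by elim: a => // a IHa p; rewrite iterSr /= phiVK IHa. Qed.

(** If the first [n] defects sum to at most [r] and [n > 2 r], one of them is
    below [1/2], which confines the point to a compact set depending on [n]. *)
Lemma ambient_kernel_proper (r : R) : exists2 C : set N, compact C &
  forall x, ambient_kernel x 1%g <= r -> C (ambient_pt x).1.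
Proof.
pose F k a : set N := iter a phi @` [set q | `|cocycle q| <= ((par k).2)^-1 + 1].
pose n := (Num.truncn (2 * `|r|)).+1.
exists (\big[setU/set0]_(k <- iota 0 n) \big[setU/set0]_(a <- iota 0 (par k).1) F k a).
  apply: bigsetU_compact => k _; apply: bigsetU_compact => a _.
  apply: continuous_compact.
    by apply: continuous_subspaceT => q; exact: iter_phi_continuous.
  by apply: cocycle_ball_compact; rewrite ltr_wpDl ?invr_ge0 ?(ltW (par_s k)).
move=> x xr.
have [k kn dk] : exists2 k, (k < n)%N & defect k x 1%g < 1 / 2.
  apply: contrapT => far.
  have {}far k : (k < n)%N -> 1 / 2 <= defect k x 1%g.
    by move=> kn; rewrite leNgt; apply/negP => lt1; apply: far; exists k.
  have : \sum_(0 <= k < n) (1 / 2 : R) <= partial_kernel n x 1%g.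
    rewrite big_nat_cond [leRHS]big_nat_cond; apply: ler_sum => k /andP[/andP[_ kn] _].
    exact: far.
  rewrite big_const_nat subn0 iter_addr_0 -mulr_natr => le1.
  have := le_trans le1 (le_trans (partial_kernel_le n x 1%g) xr).
  have := truncnS_gt (2 * `|r|); rewrite -/n; have := ler_norm r.
  by lra.
have : 1 / 2 < box_kernel (par k).1 (par k).2 (ambient_pt x) (1%g, 0).
  by move: dk; rewrite /defect ambient_pt1; lra.
case: (ambient_pt x) => q m /(box_kernel_upper (par_n k))[a an le1] /=.
rewrite -bigcup_seq; exists k.
  by change (is_true (k \in iota 0 n)); rewrite mem_iota.
rewrite -bigcup_seq; exists a.
  by change (is_true (a \in iota 0 (par k).1)); rewrite mem_iota.
exists (iter a phiV q); last exact: iter_phiK.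
move: le1; rewrite /= mulrC -ler_pdivlMr// mul1r.
move: (`|_|) (normr_ge0 (cocycle (iter a phiV q))) => c c0 le1.
have := sqr_ge0 (c - 1); rewrite sqrrB; nra.
Qed.

End Series.
End Ambient.

(** * Properness of the action of the extension *)

(** A cluster point of the image of a filter lies in the closed range, and pulls
    back because the map is open onto its range. *)
Lemma closed_inclusion_compact (L M : preTopGroupType) (f : L -> M) (C : set M) :
  is_inclusion f -> closed (range f) -> compact C -> compact (f @^-1` C).
Proof.
move=> [_ finj fc fo] fcl Cc F FF FC.
have [] := compact_closedI Cc fcl (F := f @ F).
  by rewrite /nbhs /=; apply: filterS FC => x Cx; split=> //; exists x.
move=> y [[Cy [x _ xy]] cly]; exists x; split; first by rewrite /= xy.
move=> A B FA.
rewrite nbhsE => -[U [oU Ux] UB].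
have [W oW UW] := fo U oU.
have Wx : nbhs y W.
  rewrite -xy; apply: open_nbhs_nbhs; split=> //.
  by have : (W `&` range f) (f x); [rewrite -UW; exists x|case].
have FfA : (f @ F) (f @` A) by rewrite /fmap /=; apply: filterS FA => a Aa; exists a.
have [_ [[a Aa <-] Wa]] := cly _ _ FfA Wx.
have : (W `&` range f) (f a) by split=> //; exists a.
by rewrite -UW => -[u Uu /finj ua]; exists a; split=> //; apply: UB; rewrite -ua.
Qed.

Theorem corollary1 (R : realType) (N G H : topGroupType)
    (j : G -> N) (i1 i2 : H -> G) (phi : N -> N)
    (N_lc : locally_compact [set: N])
    (N_cg : compactly_generated N)
    (j_incl : is_inclusion j) (j_closed : closed (range j))
    (i1_incl : is_inclusion i1) (i1_open : open (range i1))
    (i1_fin : finite_index (range i1))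
    (i2_incl : is_inclusion i2) (i2_open : open (range i2))
    (i2_fin : finite_index (range i2))
    (phi_aut : is_automorphism phi)
    (phi_conj : forall h : H, phi (j (i1 h)) = j (i2 h)) :
  a_T_menable R N -> a_T_menable R (hnn i1 i2).
Proof.
move=> [V [alpha [aff prop]]].
have [jM _ jc _] := j_incl.
have [phiM phic [phiV [phiK phiVK phiVc]]] := phi_aut.
have [i1M _ _ _] := i1_incl.
have /choice[par parP] :=
  box_params phiM phiK phiVK phiVc aff prop.
have par_n k : (0 < (par k).1)%N by have [] := parP k.
have par_s k : 0 < (par k).2 by have [] := parP k.
have par_le k := (let: And3 _ _ h := parP k in h).
(* Both summands of [psi] are invariant, and a bound on [psi] bounds both. *)
pose A := @ambient_kernel R N G H j i1 i2 phi phiV V alpha par.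
pose T := @tree_kernel R H G i1 i2.
pose psi x y := A x y + T x y.
have psi_cnd : cnd psi.
  by apply: cndD; [exact: ambient_kernel_cnd|exact: tree_kernel_cnd].
have psi_diag x : psi x x = 0.
  rewrite /psi /A ambient_kernel_diag// add0r /T /tree_kernel mulVg.
  by rewrite -hnn_base1 tree_dist0.
have psi_inv g x y : psi (g * x)%g (g * y)%g = psi x y.
  rewrite /psi /A ambient_kernel_inv//; congr (_ + _).
  by rewrite /T /tree_kernel invgM mulgA mulgVK.
have contl (h : hnn i1 i2) : continuous (fun g : hnn i1 i2 => (h * g)%g).
  move=> g; have := @hnn_translate_continuous H G i1 i2 h 1%g g.
  by rewrite /continuous_at mulg1; under eq_fun do rewrite mulg1.
have contr (h : hnn i1 i2) : continuous (fun g : hnn i1 i2 => (g * h)%g).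
  move=> g; have := @hnn_translate_continuous H G i1 i2 1%g h g.
  by rewrite /continuous_at mul1g; under eq_fun do rewrite mul1g.
have T1 x : T x 1%g = (tree_dist x)%:R by rewrite /T /tree_kernel invg1 mul1g.
have A0 x : 0 <= A x 1%g by exact: ambient_kernel_ge0.
have psi_cont : (fun g : hnn i1 i2 => psi g 1%g) @ (1%g : hnn i1 i2) --> (0 : R).
  apply: (cvgrPdist_lt (FF := nbhs_filter (1%g : hnn i1 i2)) _ _).2 => e e0.
  have near1 := ambient_kernel_near1 jM jc phiM phiK phiVK phiVc phi_conj aff
    par_n par_s par_le e0.
  have [U [oU U1] UA] : exists2 U : set G, open U /\ U 1%g &
      forall g, U g -> A (hnn_base i1 i2 g) 1%g < e.
    by move: near1; rewrite /prop_near1 nbhsE => -[U [oU U1] UA]; exists U.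
  apply: (@filterS _ _ (nbhs_filter (1%g : hnn i1 i2)) _ _ _
    (nbhs1_hnn_base i1 i2 oU U1)) => _ [g Ug <-].
  rewrite sub0r normrN /psi T1 tree_dist0 addr0 ger0_norm//.
  exact: UA.
pose act := gns (psi_cnd := psi_cnd) (psi_diag := psi_diag) psi_inv.
have actA := gns_affine_isometric_action psi_cnd psi_diag psi_inv contl contr psi_cont.
exists (rkhs_hilbert (gram_psd psi_cnd psi_diag)), act; split=> // v r r0.
have [_ _ iso _] := actA.
set S := [set g | _].
have S_closed : closed S by exact: gns_ball_closed.
rewrite precompact_closed//.
(* By the isometry of the action it suffices to bound the orbit of [0]. *)
pose rho := (r + `|v|) ^+ 2.
have S_psi g : S g -> psi g 1%g <= rho.
  move=> Sg; rewrite -norm_gns0.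
  have le1 : `|act g 0| <= r + `|v|.
    rewrite -[act g 0](subrK (act g v)) addrC.
    apply: (le_trans (ler_normD _ _)); apply: lerD; first exact: Sg.
    by rewrite iso sub0r normrN.
  by rewrite ler_pXn2r ?nnegrE ?normr_ge0 ?(le_trans (normr_ge0 _) le1).
have [C Cc AC] := ambient_kernel_proper jM phiM phiK phiVK phic phi_conj aff
  prop par_n par_s par_le rho.
have [i1_1 i2_1] := (inclusion1 i1_incl, inclusion1 i2_incl).
have /choice[reps repsP] := fun n => reach_finite i1_fin i2_fin n i1_1 i2_1.
(* A bound on the tree distance leaves finitely many cosets [y G], and on each of
   them the ambient kernel confines [c y * j g] to the compact set [C]. *)
pose c := fun y : hnn i1 i2 => (ambient_pt j phi phiV y).1.
pose D y : set G := j @^-1` ((fun p => ((c y)^-1 * p)%g) @` C).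
pose B := \big[setU/set0]_(n <- iota 0 (Num.truncn rho).+1)
  \big[setU/set0]_(y <- reps n) ((fun g => (y * hnn_base i1 i2 g)%g) @` D y).
apply: (@subclosed_compact _ S B) => //.
  apply: bigsetU_compact => n _; apply: bigsetU_compact => y _.
  apply: continuous_compact.
    apply: continuous_subspaceT => g.
    apply: (cvg_comp (hnn_base i1 i2) (fun x => (y * x)%g)); last exact: contl.
    exact: hnn_base_continuous.
  apply: closed_inclusion_compact => //; apply: continuous_compact => //.
  by apply: continuous_subspaceT; exact: mulg_continuous_l.
move=> x /S_psi xrho.
have [xn _] := tree_distP x; have [y [g [ys xE]]] := repsP _ _ xn.
rewrite /B -bigcup_seq; exists (tree_dist x).
  change (is_true (tree_dist x \in iota 0 (Num.truncn rho).+1)).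
  rewrite mem_iota /= add0n ltnS truncn_ge_nat ?sqr_ge0// -T1.
  by apply: le_trans xrho; rewrite /psi lerDr.
rewrite -bigcup_seq; exists y => //; exists g => //.
exists (c y * j g)%g; last by rewrite mulKg.
rewrite /c -ambient_ptM_base// -xE; apply: AC.
by apply: le_trans xrho; rewrite /psi lerDl T1.
Qed.
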